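(* There exists a signature $\Sigma=(\{\mathsf C\},\mathfrak I,\mathfrak P)$ with a single component type and a fixed finite set $\mathfrak I$ of interaction types of arities $1$ and $2$ such that the following two problems are undecidable: (LinearDeadlock) given a SID $\Delta$, a behavior map $\beta$ for $\Sigma$, and a sentence $\phi$ which is linear over $\Delta$, decide $\mathit{deadlock}(\phi,\Delta,\beta)$; (LinearReachability) given a SID $\Delta$, a behavior map $\beta$, a sentence $\phi$ linear over $\Delta$ and a state $q_1$, decide $\mathit{reach}(\phi,\langle q_1\rangle,\Delta,\beta)$.
   Context: Signatures, architectures, behavior maps, the Petri net $\mathsf N(\Sigma,\alpha,\beta)$, precise markings, configurations and the configuration logic CL with its semantics $\models_\Delta$ over a SID (set of inductive definitions) $\Delta$ are as follows. A signature $\Sigma=(\mathfrak C,\mathfrak I,\mathfrak P)$ has component types $\mathfrak C$, interaction types $\mathfrak I$ with arities $\#(\mathsf I)\ge1$, and port interface $\mathfrak P$ ($\mathfrak P(\mathsf C)$ pairwise disjoint finite port sets, $\mathfrak P(\mathsf I)=\langle p_1,\dots,p_{\#(\mathsf I)}\rangle$, $\mathrm{comp}(p)$ the type owning $p$). An architecture $\alpha$ gives sets $\alpha(\mathsf C)\subseteq\mathbb U$ and relations $\alpha(\mathsf I)\subseteq\mathbb U^{\#(\mathsf I)}$ over a countably infinite set $\mathbb U$. A behavior map $\beta$ gives each $\mathsf C$ a finite state machine with states $Q_{\mathsf C}$ (pairwise disjoint), transitions $q\xrightarrow{p}q'$ with $p\in\mathfrak P(\mathsf C)$. $\mathsf N(\Sigma,\alpha,\beta)$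 has places $q[u]$ ($q\in Q_{\mathsf C}$, $u\in\alpha(\mathsf C)$) and transitions $(\mathsf I[u_1..u_k],\langle t_1..t_k\rangle)$ for $\langle u_i\rangle\in\alpha(\mathsf I)$, $t_i=(q_i\xrightarrow{p_i}q_i')$ a transition of $\beta(\mathrm{comp}(p_i))$, $\mathfrak P(\mathsf I)=\langle p_1..p_k\rangle$, with $u_i\neq u_j$ or $\mathrm{comp}(p_i)\neq\mathrm{comp}(p_j)$ for $i\ne j$; its pre-set is $\{q_i[u_i]\}$ and post-set $\{q_i'[u_i]\}$. Firing and reachability are standard; markings are sets of places; $\mathrm{Dead}(\mathsf N)$ is the set of markings enabling no transition. A marking is precise if each component $u\in\alpha(\mathsf C)$ has exactly one marked place $q[u]$. A configuration is $(\alpha,m)$ with $m$ precise. CL formulas: $\phi::=\mathsf{emp}\mid\mathsf C(x)\mid\mathsf C^q(x)\mid\mathsf I(x_1..x_{\#(\mathsf I)})\mid\mathsf A(x_1..x_{\#(\mathsf A)})\mid\phi*\phi\mid\exists x.\phi$; a SID is a finite set of rules $\mathsf A(x_1..x_n)\leftarrow\phi$ with $\mathrm{fv}(\phi)=\{x_1..x_n\}$; $(\alpha,m)\models^s_\Delta\phi$ is the least relation where $\mathsf{emp}$ means empty architecture and empty marking, $\mathsf C(x)$ (resp. $\mathsf C^q(x)$) means the architecture has only the component $\mathsf C[s(x)]$ and $m=\{q[s(x)]\}$ for some $q$ (resp. that $q$), $\mathsf I(\vec x)$ means the architecture has only the interaction $\mathsf I[s(\vec x)]$ and $m=\emptyset$,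 predicate atoms are unfolded by rules of $\Delta$, $*$ splits the configuration into two parts with disjoint architectures (pointwise disjoint component sets and interaction relations), and $\exists$ is existential choice of the store value. $\phi\models_\Delta\psi$ for sentences means every model of $\phi$ is a model of $\psi$. Decision problems: $\mathit{deadlock}(\phi,\Delta,\beta)$ asks whether there is a configuration $(\alpha,m)\models_\Delta\phi$ with $\mathrm{Reach}(\mathsf N(\Sigma,\alpha,\beta),m)\cap\mathrm{Dead}(\mathsf N(\Sigma,\alpha,\beta))\neq\emptyset$. $\mathit{reach}(\phi,\langle q_1,\dots,q_k\rangle,\Delta,\beta)$ asks whether there exist $(\alpha,m)\models_\Delta\phi$, $m'\in\mathrm{Reach}(\mathsf N(\Sigma,\alpha,\beta),m)$ and indices $u_1,\dots,u_k$ with $q_1[u_1],\dots,q_k[u_k]$ pairwise distinct and all in $m'$. Linearity: for $\Sigma=(\{\mathsf C\},\mathfrak I,\mathfrak P)$ let $\mathfrak I^{(k)}$ be the interaction types of arity $k$ and let $\Lambda$ consist of the rules $\mathsf L(x,x)\leftarrow\mathsf C(x)*\mathop{\ast}_{\mathsf I\in\mathfrak I^{(1)}}\mathsf I(x)$ and $\mathsf L(x,y)\leftarrow\exists z.\ \mathsf C(x)*\mathop{\ast}_{\mathsf I\in\mathfrak I^{(1)}}\mathsf I(x)*\mathop{\ast}_{\mathsf I\in\mathfrak I^{(2)}}\mathsf I(x,z)*\mathsf L(z,y)$, with $\mathsf L$ a binary predicate symbol not used in $\Delta$. A sentence $\phi$ is linear over $\Delta$ iff $\phi\models_{\Delta\cup\Lambda}\exists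 x\exists y.\ \mathsf L(x,y)$. *)

(* Defs.v *)
From Stdlib Require List.
From mathcomp Require Import all_boot.
Set Implicit Arguments. Unset Strict Implicit. Unset Printing Implicit Defensive.

(* Signatures with a single component type C.                                 *)
(* Ports of C are the naturals < sig_nports.  Interaction type number i       *)
(* (i < size sig_inter) has port tuple P(I_i) = nth [::] sig_inter i, so its   *)
(* arity is the size of that list.  comp(p) = C for every port.              *)
Record signature := Signature { sig_nports : nat; sig_inter : seq (seq nat) }.

Definition inter_ports (S : signature) (i : nat) : seq nat := nth [::] (sig_inter S) i.
Definition arity (S : signature) (i : nat) : nat := size (inter_ports S i).

Definition sig_ok_12 (S : signature) : Prop :=
  (forall ps, ps \in sig_inter S -> (size ps == 1) || (size ps == 2)) /\
  (forall ps p, ps \in sig_inter S -> p \in ps -> p < sig_nports S).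

(* Behaviour map for the single component type: states are naturals < beh_nst,
   transitions (q, p, q') mean q --p--> q'. *)
Record behavior := Behavior { beh_nst : nat; beh_trans : seq (nat * nat * nat) }.

Definition beh_wf (S : signature) (B : behavior) : Prop :=
  forall t, t \in beh_trans B ->
    [/\ t.1.1 < beh_nst B, t.1.2 < sig_nports S & t.2 < beh_nst B].

Inductive form :=
| Emp
| Comp (x : nat)
| CompSt (q : nat) (x : nat)
| Inter (i : nat) (xs : seq nat)
| Pred (a : nat) (xs : seq nat)
| Sep (f g : form)
| Ex (x : nat) (f : form).

Fixpoint fv (f : form) : seq nat :=
  match f with
  | Emp => [::]
  | Comp x => [:: x]
  | CompSt _ x => [:: x]
  | Inter _ xs => xs
  | Pred _ xs => xs
  | Sep f g => fv f ++ fv g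
  | Ex x f => [seq z <- fv f | z != x]
  end.

(* A rule  A(x_1..x_n) <- body  is (A, [:: x_1; ..; x_n], body). *)
Definition rule := (nat * seq nat * form)%type.
Definition SID := seq rule.

Fixpoint wf_form (S : signature) (nst : nat) (D : SID) (f : form) : Prop :=
  match f with
  | Emp | Comp _ => True
  | CompSt q _ => q < nst
  | Inter i xs => i < size (sig_inter S) /\ size xs = arity S i
  | Pred a ys => forall r, List.In r D -> r.1.1 = a -> size ys = size r.1.2
  | Sep f g => wf_form S nst D f /\ wf_form S nst D g
  | Ex _ f => wf_form S nst D f
  end.

Definition wf_SID (S : signature) (nst : nat) (D : SID) : Prop :=
  forall r, List.In r D ->
    [/\ wf_form S nst D r.2,
        (forall z, z \in fv r.2 <-> z \in r.1.2) &
        (forall r', List.In r' D -> r'.1.1 = r.1.1 -> size r'.1.2 = size r.1.2)].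

(* Configurations (architecture + marking).  Universe U = nat.
   ccomp u    : u \in alpha(C)
   cinter i t : t \in alpha(I_i)
   cmark q u  : place q[u] is marked. *)
Record config := Config {
  ccomp : nat -> Prop;
  cinter : nat -> seq nat -> Prop;
  cmark : nat -> nat -> Prop }.

Definition store := nat -> nat.
Definition supd (s : store) (x v : nat) : store := fun z => if z == x then v else s z.

Definition no_comp (c : config) := forall u, ~ ccomp c u.
Definition no_inter (c : config) := forall i t, ~ cinter c i t.
Definition no_mark (c : config) := forall q u, ~ cmark c q u.

Definition disj_union (c c1 c2 : config) : Prop :=
  (forall u, ccomp c u <-> ccomp c1 u \/ ccomp c2 u) /\
  (forall u, ~ (ccomp c1 u /\ ccomp c2 u)) /\
  (forall i t, cinter c i t <-> cinter c1 i t \/ cinter c2 i t) /\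
  (forall i t, ~ (cinter c1 i t /\ cinter c2 i t)) /\
  (forall q u, cmark c q u <-> cmark c1 q u \/ cmark c2 q u).

Inductive sat (nst : nat) (D : SID) : store -> form -> config -> Prop :=
| sat_emp s c : no_comp c -> no_inter c -> no_mark c -> sat nst D s Emp c
| sat_comp s x q c :
    q < nst ->
    (forall u, ccomp c u <-> u = s x) -> no_inter c ->
    (forall q' u, cmark c q' u <-> q' = q /\ u = s x) ->
    sat nst D s (Comp x) c
| sat_compst s x q c :
    q < nst ->
    (forall u, ccomp c u <-> u = s x) -> no_inter c ->
    (forall q' u, cmark c q' u <-> q' = q /\ u = s x) ->
    sat nst D s (CompSt q x) c
| sat_inter s i xs c :
    no_comp c -> (forall j t, cinter c j t <-> j = i /\ t = map s xs) -> no_mark c ->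
    sat nst D s (Inter i xs) c
| sat_pred s a ys xs body s' c :
    List.In (a, xs, body) D -> size xs = size ys ->
    (forall j, j < size xs -> s' (nth 0 xs j) = s (nth 0 ys j)) ->
    sat nst D s' body c ->
    sat nst D s (Pred a ys) c
| sat_sep s f g c c1 c2 :
    sat nst D s f c1 -> sat nst D s g c2 -> disj_union c c1 c2 ->
    sat nst D s (Sep f g) c
| sat_ex s x v f c :
    sat nst D (supd s x v) f c -> sat nst D s (Ex x f) c.

Definition store0 : store := fun _ => 0.
Definition sentence (f : form) : Prop := fv f = [::].

Definition precise (nst : nat) (c : config) : Prop :=
  (forall u, ccomp c u -> exists q, [/\ q < nst, cmark c q u &
                                       forall q', cmark c q' u -> q' = q]) /\
  (forall q u, cmark c q u -> ccomp c u /\ q < nst).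

Definition marking := nat -> nat -> Prop.

(* transition (I_i[u_1..u_k], <t_1..t_k>) *)
Record ptrans := PTrans { pt_i : nat; pt_us : seq nat; pt_ts : seq (nat * nat * nat) }.

Definition is_trans (S : signature) (B : behavior) (c : config) (t : ptrans) : Prop :=
  [/\ pt_i t < size (sig_inter S),
      cinter c (pt_i t) (pt_us t),
      size (pt_us t) = arity S (pt_i t) /\ size (pt_ts t) = arity S (pt_i t),
      (forall j, j < size (pt_ts t) ->
         nth (0,0,0) (pt_ts t) j \in beh_trans B /\
         (nth (0,0,0) (pt_ts t) j).1.2 = nth 0 (inter_ports S (pt_i t)) j) &
      uniq (pt_us t)].

Definition pre (t : ptrans) (q u : nat) : Prop :=
  exists2 j, j < size (pt_us t) &
    q = (nth (0,0,0) (pt_ts t) j).1.1 /\ u = nth 0 (pt_us t) j.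
Definition post (t : ptrans) (q u : nat) : Prop :=
  exists2 j, j < size (pt_us t) &
    q = (nth (0,0,0) (pt_ts t) j).2 /\ u = nth 0 (pt_us t) j.

Definition enabled (t : ptrans) (m : marking) : Prop := forall q u, pre t q u -> m q u.

Definition fires (t : ptrans) (m m' : marking) : Prop :=
  enabled t m /\
  forall q u, m' q u <-> (m q u /\ ~ pre t q u) \/ post t q u.

Inductive reachable (S : signature) (B : behavior) (c : config) (m0 : marking)
  : marking -> Prop :=
| reach_refl m : (forall q u, m q u <-> m0 q u) -> reachable S B c m0 m
| reach_step m1 m2 t :
    reachable S B c m0 m1 -> is_trans S B c t -> fires t m1 m2 ->
    reachable S B c m0 m2.

Definition dead (S : signature) (B : behavior) (c : config) (m : marking) : Prop :=
  forall t, is_trans S B c t -> ~ enabled t m.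

Definition deadlock (S : signature) (phi : form) (D : SID) (B : behavior) : Prop :=
  exists c, [/\ sat (beh_nst B) D store0 phi c, precise (beh_nst B) c &
    exists2 m', reachable S B c (cmark c) m' & dead S B c m'].

Definition reach1 (S : signature) (phi : form) (q1 : nat) (D : SID) (B : behavior) : Prop :=
  exists c, [/\ sat (beh_nst B) D store0 phi c, precise (beh_nst B) c &
    exists2 m', reachable S B c (cmark c) m' & exists u, m' q1 u].

Fixpoint preds_form (f : form) : seq nat :=
  match f with
  | Pred a _ => [:: a]
  | Sep f g => preds_form f ++ preds_form g
  | Ex _ f => preds_form f
  | _ => [::]
  end.

Definition freshL (D : SID) (phi : form) : nat :=
  (\max_(a <- preds_form phi ++ flatten [seq r.1.1 :: preds_form r.2 | r <- D]) a).+1.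

Definition seps (fs : seq form) : form := foldr Sep Emp fs.

Definition inters_of_arity (S : signature) (k : nat) : seq nat :=
  [seq i <- iota 0 (size (sig_inter S)) | arity S i == k].

(* Lambda, with variables x = 0, y = 1, z = 2 *)
Definition Lambda (S : signature) (L : nat) : SID :=
  [:: (L, [:: 0; 0],
        Sep (Comp 0) (seps [seq Inter i [:: 0] | i <- inters_of_arity S 1]));
      (L, [:: 0; 1],
        Ex 2 (Sep (Comp 0)
               (Sep (seps [seq Inter i [:: 0] | i <- inters_of_arity S 1])
                (Sep (seps [seq Inter i [:: 0; 2] | i <- inters_of_arity S 2])
                     (Pred L [:: 2; 1])))))].

Definition linear (S : signature) (nst : nat) (D : SID) (phi : form) : Prop :=
  let L := freshL D phi in
  forall c, sat nst (D ++ Lambda S L) store0 phi c ->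
            sat nst (D ++ Lambda S L) store0 (Ex 0 (Ex 1 (Pred L [:: 0; 1]))) c.

Inductive instr := Inc (r : nat) | Dec (r : nat) (j : nat).

Definition regs := nat -> nat.
Definition rupd (f : regs) (r v : nat) : regs := fun x => if x == r then v else f x.

Definition rm_step (M : seq instr) (cf : nat * regs) : nat * regs :=
  let: (pc, f) := cf in
  if size M <= pc then (pc, f) else
  match nth (Inc 0) M pc with
  | Inc r => (pc.+1, rupd f r (f r).+1)
  | Dec r j => if f r is k.+1 then (pc.+1, rupd f r k) else (j, f)
  end.

Definition rm_computes (M : seq instr) (n v : nat) : Prop :=
  exists k, let cf := iter k (rm_step M) (0, rupd (fun _ => 0) 0 n) in
            size M <= cf.1 /\ cf.2 0 = v.

Definition decidable_on (I : Type) (enc : I -> nat) (valid : I -> Prop) (P : I -> Prop) : Prop :=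
  exists M : seq instr, forall i, valid i ->
    exists b : bool, rm_computes M (enc i) b /\ (P i <-> b = true).

Definition cpair (a b : nat) : nat := 2 ^ a * (2 * b + 1).
Fixpoint enc_list (l : seq nat) : nat :=
  if l is x :: l' then (cpair x (enc_list l')).+1 else 0.
Fixpoint enc_form (f : form) : nat :=
  match f with
  | Emp => cpair 0 0
  | Comp x => cpair 1 x
  | CompSt q x => cpair 2 (cpair q x)
  | Inter i xs => cpair 3 (cpair i (enc_list xs))
  | Pred a xs => cpair 4 (cpair a (enc_list xs))
  | Sep f g => cpair 5 (cpair (enc_form f) (enc_form g))
  | Ex x f => cpair 6 (cpair x (enc_form f))
  end.
Definition enc_rule (r : rule) : nat := cpair r.1.1 (cpair (enc_list r.1.2) (enc_form r.2)).
Definition enc_SID (D : SID) : nat := enc_list (map enc_rule D).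
Definition enc_beh (B : behavior) : nat :=
  cpair (beh_nst B) (enc_list [seq cpair t.1.1 (cpair t.1.2 t.2) | t <- beh_trans B]).

Definition dl_instance := (SID * behavior * form)%type.
Definition enc_dl (x : dl_instance) : nat :=
  cpair (enc_SID x.1.1) (cpair (enc_beh x.1.2) (enc_form x.2)).
Definition valid_dl (S : signature) (x : dl_instance) : Prop :=
  let: (D, B, phi) := x in
  [/\ wf_SID S (beh_nst B) D, beh_wf S B, wf_form S (beh_nst B) D phi,
      sentence phi & linear S (beh_nst B) D phi].
Definition LinearDeadlock (S : signature) (x : dl_instance) : Prop :=
  let: (D, B, phi) := x in deadlock S phi D B.

Definition re_instance := (SID * behavior * form * nat)%type.
Definition enc_re (x : re_instance) : nat :=
  cpair (enc_dl x.1) x.2.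
Definition valid_re (S : signature) (x : re_instance) : Prop :=
  let: (D, B, phi, q1) := x in valid_dl S (D, B, phi) /\ q1 < beh_nst B.
Definition LinearReachability (S : signature) (x : re_instance) : Prop :=
  let: (D, B, phi, q1) := x in reach1 S phi q1 D B.

(* Main.v *)
(* Suppose a register machine M decides one of the problems.  Let [diag_machine]
   read a number n, compute the code of the instance whose behaviour has code n
   and whose formula stores n in register 0, run M on it, and halt exactly if M
   answers no.  A behaviour that simulates this machine, taken with its own code
   as n, gives an instance on which M errs; so no universal machine is needed.

   The net simulating a register machine Q is a chain: a controller, cells that
   each store at most one unit of one register, and a last cell.  Since the
   signature may not depend on Q, the controller names a register by sending
   along the chain as many rotation messages as needed to bring a pointer held by
   every cell to that register; only then it sends "increment" or "decrement".
   Exactly one component is active at any time and it can spin unless it is the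
   controller in state [Halt]; hence a marking is dead iff [Halt] is marked, and
   the run is deterministic up to spinning.  An increment that finds no free cell
   spins forever, and a chain that is long enough simulates a halting run. *)
From Stdlib Require List.
From HB Require Import structures.
Require Import Defs.
From mathcomp Require Import all_boot.
From mathcomp Require Import zify.
Set Implicit Arguments. Unset Strict Implicit. Unset Printing Implicit Defensive.

(** * Diagonalisation by register machines *)

(** Register contents are functions, so configurations are compared pointwise. *)
Definition same_conf (cf cg : nat * regs) := cf.1 = cg.1 /\ cf.2 =1 cg.2.

Lemma same_conf_step M cf cg :
  same_conf cf cg -> same_conf (rm_step M cf) (rm_step M cg).
Proof.
case: cf cg => [pc f] [pc' g] [/= <- fg].
case: ifP => // _; case: (nth _ _ _) => [r|r j].
  by split=> //= x; rewrite /rupd fg; case: eqP.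
by rewrite fg; case: (g r) => [|k]; split=> //= x; rewrite /rupd fg.
Qed.

Lemma same_conf_iter M k cf cg :
  same_conf cf cg -> same_conf (iter k (rm_step M) cf) (iter k (rm_step M) cg).
Proof. by move=> h; elim: k => //= k; apply: same_conf_step. Qed.

Definition rsteps M (cf cg : nat * regs) :=
  exists k, same_conf (iter k (rm_step M) cf) cg.

Lemma rsteps_trans M b a c : rsteps M a b -> rsteps M b c -> rsteps M a c.
Proof.
move=> [k [h1 h2]] [k' [h3 h4]]; exists (k' + k); rewrite iterD.
have [e1 e2] := same_conf_iter M k' (conj h1 h2).
by split; [rewrite e1|move=> x; rewrite e2].
Qed.

Lemma rsteps_refl M a : rsteps M a a.
Proof. by exists 0. Qed.

Lemma rsteps1 M a b : same_conf (rm_step M a) b -> rsteps M a b.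
Proof. by exists 1. Qed.

(** * Loop programs and their compilation to register machines *)

Inductive cmd := Skip | Incr (r : nat) | Seq (c d : cmd) | Loop (r : nat) (c : cmd).

(** A loop decrements its register before each pass, as [Dec] does on a nonzero register. The memory
    is a list read with default 0. *)
Inductive exec : cmd -> seq nat -> seq nat -> Prop :=
| exec_skip l : exec Skip l l
| exec_incr r l : exec (Incr r) l (set_nth 0 l r (nth 0 l r).+1)
| exec_seq c d l l1 l2 : exec c l l1 -> exec d l1 l2 -> exec (Seq c d) l l2
| exec_loop0 r c l : nth 0 l r = 0 -> exec (Loop r c) l l
| exec_loopS r c l l1 l2 k : nth 0 l r = k.+1 -> exec c (set_nth 0 l r k) l1 ->
    exec (Loop r c) l1 l2 -> exec (Loop r c) l l2.

Fixpoint cregs (c : cmd) : seq nat :=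
  match c with
  | Skip => [::]
  | Incr r => [:: r]
  | Seq c d => cregs c ++ cregs d
  | Loop r c => r :: cregs c
  end.

Fixpoint clen (c : cmd) : nat :=
  match c with
  | Skip => 0
  | Incr r => 1
  | Seq c d => clen c + clen d
  | Loop r c => (clen c).+2
  end.

(* The register z stays 0, so [Dec z j] is an unconditional jump to j. *)
Fixpoint compile (z off : nat) (c : cmd) : seq instr :=
  match c with
  | Skip => [::]
  | Incr r => [:: Inc r]
  | Seq c d => compile z off c ++ compile z (off + clen c) d
  | Loop r c => Dec r (off + (clen c).+2) :: compile z off.+1 c ++ [:: Dec z off]
  end.

Lemma size_compile z off c : size (compile z off c) = clen c.
Proof.
elim: c off => //= [c IHc d IHd|r c IHc] off; rewrite ?size_cat ?IHc ?IHd //=.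
by rewrite addn1.
Qed.

Lemma exec_frame z c l l' : exec c l l' -> z \notin cregs c -> nth 0 l' z = nth 0 l z.
Proof.
elim=> //= {c l l'} [r l|c d l l1 l2 _ IH1 _ IH2|r c l l1 l2 k hk _ IH1 _ IH2].
- by rewrite inE nth_set_nth /= => /negPf ->.
- by rewrite mem_cat negb_or => /andP[/IH1 <- /IH2].
- rewrite inE negb_or => /andP[zr zc]; rewrite IH2 ?inE ?negb_or ?zr // IH1 //.
  by rewrite nth_set_nth /= (negPf zr).
Qed.

Lemma rm_step_nth M pc f i : pc < size M -> nth (Inc 0) M pc = i ->
  rm_step M (pc, f) =
  match i with
  | Inc r => (pc.+1, rupd f r (f r).+1)
  | Dec r j => if f r is k.+1 then (pc.+1, rupd f r k) else (j, f)
  end.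
Proof. by move=> h <-; rewrite /rm_step leqNgt h. Qed.

Lemma nth_mid (pre post : seq instr) i : nth (Inc 0) (pre ++ i :: post) (size pre) = i.
Proof. by rewrite nth_cat ltnn subnn. Qed.

(** Induction on the execution. Jumps are computed from the offset [size pre], so the code may sit
    anywhere inside [M]; hence the induction hypotheses apply to the parts of a sequence and to a
    loop body. *)
Lemma compile_correct z c l l' : exec c l l' ->
  z \notin cregs c -> nth 0 l z = 0 ->
  forall M pre post, M = pre ++ compile z (size pre) c ++ post ->
  rsteps M (size pre, nth 0 l) (size pre + clen c, nth 0 l').
Proof.
elim=> {c l l'} [l|r l|c d l l1 l2 e1 IH1 e2 IH2|r c l h|r c l l1 l2 k hk e1 IH1 e2 IH2]
  /= zc z0 M pre post defM.
- by rewrite addn0; apply: rsteps_refl.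
- apply: rsteps1; rewrite (@rm_step_nth _ _ _ (Inc r)); last 2 first.
  + by rewrite defM size_cat /=; lia.
  + by rewrite defM nth_mid.
  by split=> /=; [rewrite addn1|move=> x; rewrite /rupd nth_set_nth].
- move: zc; rewrite mem_cat negb_or => /andP[zc zd].
  apply: (rsteps_trans (IH1 zc z0 M pre (compile z (size pre + clen c) d ++ post) _)).
    by rewrite defM -catA.
  have z1 : nth 0 l1 z = 0 by rewrite (exec_frame e1 zc).
  have:= IH2 zd z1 M (pre ++ compile z (size pre) c) post.
  by rewrite size_cat size_compile -!catA addnA; apply; rewrite defM -catA.
- apply: rsteps1; rewrite (@rm_step_nth _ _ _ (Dec r (size pre + (clen c).+2))).
  + by rewrite h.
  + by rewrite defM size_cat /=; lia.
  by rewrite defM nth_mid.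
- have zc' := zc; move: zc; rewrite inE negb_or => /andP[zr zc].
  have z0' : nth 0 (set_nth 0 l r k) z = 0 by rewrite nth_set_nth /= (negPf zr).
  have z1 : nth 0 l1 z = 0 by rewrite (exec_frame e1 zc).
  apply: (@rsteps_trans _ ((size pre).+1, nth 0 (set_nth 0 l r k))).
    apply: rsteps1; rewrite (@rm_step_nth _ _ _ (Dec r (size pre + (clen c).+2))).
    + by rewrite hk; split=> //= x; rewrite /rupd nth_set_nth.
    + by rewrite defM size_cat /=; lia.
    by rewrite defM nth_mid.
  have:= IH1 zc z0' M (rcons pre (Dec r (size pre + (clen c).+2))) (Dec z (size pre) :: post).
  rewrite size_rcons => /(_ _)/rsteps_trans; apply.
    by rewrite defM -cats1 -!catA /= -?catA.
  (* The closing [Dec z] finds 0 and jumps back to the loop test. *)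
  apply: rsteps_trans (IH2 zc' z1 M pre post defM).
  apply: rsteps1; rewrite (@rm_step_nth _ _ _ (Dec z (size pre))).
  + by rewrite z1.
  + by rewrite defM !size_cat /= !size_cat size_compile /=; lia.
  have -> : M = (pre ++ Dec r (size pre + (clen c).+2) :: compile z (size pre).+1 c)
     ++ Dec z (size pre) :: post by rewrite defM -!catA /= -?catA.
  rewrite -[X in nth _ _ X](_ : size (pre ++ Dec r (size pre + (clen c).+2) :: compile z (size pre).+1 c) = _) ?nth_mid //.
  by rewrite size_cat /= size_compile; lia.
Qed.

(** * The diagonal machine *)

Definition input (n : nat) : regs := rupd (fun _ => 0) 0 n.

Definition rm_halts (M : seq instr) (n : nat) :=
  exists k, size M <= (iter k (rm_step M) (0, input n)).1.

Definition loop_computes (c : cmd) (F : nat -> nat) :=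
  forall n, exec c [:: n; 0; 0; 0; 0] [:: F n; 0; 0; 0; 0].

Definition ireg (i : instr) := match i with Inc r => r | Dec r _ => r end.

(** A jump of [M] beyond its end halts; clamping the target to [sz] makes all such jumps land right
    after the copy of [M]. *)
Definition shift_instr (off sz : nat) (i : instr) :=
  match i with Inc r => Inc r | Dec r j => Dec r (off + minn j sz) end.

Lemma iter_fixed T (f : T -> T) x k : f x = x -> iter k f x = x.
Proof. by move=> h; elim: k => //= k ->. Qed.

Section Diagonal.
Variables (M : seq instr) (c : cmd).

(** The summand 5 keeps [z] off the five registers initialised in [loop_computes], so that it starts
    at 0. *)
Let z := (\max_(r <- cregs c ++ [seq ireg i | i <- M]) r).+1 + 5.
Let off := clen c.
Let sz := size M.

(* Run M on the output of c, then halt exactly if the answer is 0. *)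
Definition diag_machine : seq instr :=
  compile z 0 c ++ [seq shift_instr off sz i | i <- M] ++
  [:: Dec 0 (off + sz).+2; Dec z (off + sz).+1].

Let Q := diag_machine.

Lemma size_diag : size Q = (off + sz).+2.
Proof. by rewrite /Q /diag_machine !size_cat size_compile size_map /=; lia. Qed.

Lemma diag_fresh r : r \in cregs c ++ [seq ireg i | i <- M] -> r != z.
Proof.
move=> h; rewrite /z neq_ltn ltn_addr // ltnS.
exact: (@leq_bigmax_seq _ _ predT id r h isT).
Qed.

Lemma diag_step pc f : pc < sz ->
  let cf := rm_step M (pc, f) in
  rm_step Q (off + pc, f) = (off + minn cf.1 sz, cf.2) /\ cf.2 z = f z.
Proof.
move=> h cf.
have e : nth (Inc 0) Q (off + pc) = shift_instr off sz (nth (Inc 0) M pc).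
  rewrite /Q /diag_machine nth_cat size_compile ifN -?leqNgt ?leq_addr //.
  by rewrite addKn nth_cat size_map h (nth_map (Inc 0)).
have hQ : off + pc < size Q by rewrite size_diag; move: h; rewrite /sz; lia.
have hz : z != ireg (nth (Inc 0) M pc).
  rewrite eq_sym diag_fresh // mem_cat -(nth_map _ 0) // mem_nth ?orbT //.
  by rewrite size_map.
rewrite {}/cf (rm_step_nth _ hQ e) (rm_step_nth _ h erefl).
case: (nth _ _ _) hz => [r|r j] /= hz.
  by rewrite /rupd (negPf hz) (minn_idPl _) ?addnS.
case: (f r) => [|k] //=.
by rewrite /rupd (negPf hz) (minn_idPl _) ?addnS.
Qed.

(** Once [M] has halted its configuration is fixed, whereas [Q] would go on; so [k'] may be smaller
    than [k]. *)
Lemma diag_iter k pc f : exists k',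
  let cf := iter k (rm_step M) (pc, f) in
  iter k' (rm_step Q) (off + minn pc sz, f) = (off + minn cf.1 sz, cf.2) /\ cf.2 z = f z.
Proof.
elim: k => [|k [k' /=]]; first by exists 0.
case: (iter k _ _) => pc1 f1 /= [e1 e2].
rewrite -/sz; case: leqP => h; first by exists k'.
exists k'.+1; rewrite iterS e1 (minn_idPl _) 1?ltnW //.
by have := diag_step f1 h; rewrite /= -/sz [sz <= _]leqNgt h => -[-> ->].
Qed.

Lemma diag_halts F n (b : bool) : loop_computes c F ->
  rm_computes M (F n) b -> (rm_halts Q n <-> b = false).
Proof.
move=> hc [k /= [hk1 hk2]].
have zc : z \notin cregs c.
  by apply/negP => h; have := @diag_fresh z; rewrite eqxx mem_cat h => /(_ isT).
have := compile_correct (hc n) zc _ (M := Q) (pre := [::])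
   (post := [seq shift_instr off sz i | i <- M] ++ [:: Dec 0 (off + sz).+2; Dec z (off + sz).+1]).
have -> : nth 0 [:: n; 0; 0; 0; 0] z = 0 by rewrite nth_default //= /z; lia.
move=> /(_ erefl erefl) /= => h1.
have h2 : rsteps Q (0, input n) (off, input (F n)).
  case: h1 => k1 [h11 h12].
  have [e1 e2] : same_conf (iter k1 (rm_step Q) (0, input n))
     (iter k1 (rm_step Q) (0, nth 0 [:: n; 0; 0; 0; 0])).
    apply: same_conf_iter; split=> //= x; rewrite /input /rupd.
    by case: x => [|[|[|[|[|]]]]] //= x; rewrite nth_nil.
  exists k1; split; first by rewrite e1 h11.
  move=> x; rewrite e2 h12 /= /input /rupd.
  by case: x => [|[|[|[|[|]]]]] //= x; rewrite nth_nil.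
have [k' /=] := diag_iter k 0 (input (F n)).
rewrite (minn_idPr hk1) min0n addn0 => -[e1 e2].
have z0 : input (F n) z = 0 by rewrite /input /rupd /z; case: eqP => //; lia.
move: e1 e2; set g := (iter k _ _).2 in hk2 * => e1 gz.
have [k2 [s1 s2]] : rsteps Q (0, input n) (off + sz, g).
  by apply: rsteps_trans h2 _; exists k'; rewrite e1.
(* Answer 0 jumps to the end of [Q]; answer 1 is decremented and falls through to the last
   instruction. *)
have e3 : rm_step Q (off + sz, g) = if b then ((off + sz).+1, rupd g 0 0) else ((off + sz).+2, g).
  rewrite (@rm_step_nth _ _ _ (Dec 0 (off + sz).+2)) ?hk2.
  - by case: (b).
  - by rewrite size_diag; lia.
  rewrite /Q /diag_machine nth_cat size_compile ifN -?leqNgt ?leq_addr // addKn.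
  by rewrite nth_cat size_map ltnn subnn.
split=> [[k3 hk3]|hb]; last first.
  exists k2.+1; rewrite iterS.
  have [-> _] := same_conf_step Q (conj s1 s2).
  by rewrite e3 hb size_diag.
case: b hk2 e3 => // hb e3.
(* The last instruction jumps to itself because register [z] is 0. *)
have e4 : rm_step Q ((off + sz).+1, rupd g 0 0) = ((off + sz).+1, rupd g 0 0).
  rewrite (@rm_step_nth _ _ _ (Dec z (off + sz).+1)).
  - by have -> : rupd g 0 0 z = 0 by rewrite /rupd gz z0; case: eqP.
  - by rewrite size_diag.
  rewrite /Q /diag_machine nth_cat size_compile ifN -?leqNgt -?addnS ?leq_addr // addKn.
  by rewrite nth_cat size_map ltnNge leqnSn /= subSn // subnn.
(* A halted configuration is fixed as well. After [k3 + k2.+1] steps both fixed points would be the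
   current configuration, but only one has its program counter inside [Q]. *)
have h4 : rm_step Q (iter k3 (rm_step Q) (0, input n)) = iter k3 (rm_step Q) (0, input n).
  by case: (iter _ _ _) hk3 => pc f /= ->.
have := iter_fixed k2.+1 h4.
rewrite -iterD addnC iterD => e5.
have [e6 _] := same_conf_iter Q k3 (same_conf_step Q (conj s1 s2)).
by move: hk3; rewrite -e5 iterS e6 e3 iter_fixed //= size_diag ltnn.
Qed.

End Diagonal.

(** * Loop programs that compute codes of instances *)

Fixpoint repeat_cmd (n : nat) (c : cmd) : cmd :=
  if n is m.+1 then Seq c (repeat_cmd m c) else Skip.

(** Register 3 is the accumulator, register 4 is scratch. As [cpair a b] is [2 ^ a * (2 * b + 1)], a
    pairing consists of doublings and one increment. *)
Definition double_cmd : cmd :=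
  Seq (Loop 3 (Seq (Incr 4) (Incr 4))) (Loop 4 (Incr 3)).

Definition pair_const_cmd (a : nat) : cmd :=
  Seq double_cmd (Seq (Incr 3) (repeat_cmd a double_cmd)).

Definition pair_input_cmd : cmd :=
  Seq double_cmd (Seq (Incr 3) (Loop 2 double_cmd)).

(** The list holds, from the inside out, the first components of nested pairs around [x]; a formula
    context becomes a list of constants. *)
Definition cpairs (es : seq nat) (x : nat) : nat := foldl (fun y a => cpair a y) x es.

Definition cpairs_cmd (es : seq nat) : cmd :=
  foldr (fun a c => Seq (pair_const_cmd a) c) Skip es.

Lemma exec_loopS_by r c l l' l1 l2 k : nth 0 l r = k.+1 -> set_nth 0 l r k = l' ->
  exec c l' l1 -> exec (Loop r c) l1 l2 -> exec (Loop r c) l l2.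
Proof. by move=> h1 <-; apply: exec_loopS. Qed.

Lemma exec_incr_by r l l' : set_nth 0 l r (nth 0 l r).+1 = l' -> exec (Incr r) l l'.
Proof. by move=> <-; apply: exec_incr. Qed.

Ltac exec_iteration :=
  eapply exec_loopS_by; [reflexivity | reflexivity |
    repeat first [eapply exec_incr_by; reflexivity | eapply exec_seq] | cbn [set_nth]].

Lemma exec_double a b n x : exec double_cmd [:: a; b; n; x; 0] [:: a; b; n; 2 * x; 0].
Proof.
have h1 y : exec (Loop 3 (Seq (Incr 4) (Incr 4))) [:: a; b; n; x; y] [:: a; b; n; 0; y + 2 * x].
  elim: x y => [|x IH] y; first by rewrite addn0; apply: exec_loop0.
  exec_iteration.
  by have -> : y + 2 * x.+1 = y.+2 + 2 * x by lia.
have h2 y w : exec (Loop 4 (Incr 3)) [:: a; b; n; w; y] [:: a; b; n; w + y; 0].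
  elim: y w => [|y IH] w; first by rewrite addn0; apply: exec_loop0.
  exec_iteration.
  by rewrite addnS -addSn.
exact: exec_seq (h1 0) (h2 _ 0).
Qed.

Lemma exec_repeat_double k a b n x :
  exec (repeat_cmd k double_cmd) [:: a; b; n; x; 0] [:: a; b; n; 2 ^ k * x; 0].
Proof.
elim: k x => [|k IH] x; first by rewrite mul1n; apply: exec_skip.
by rewrite expnSr -mulnA; apply: exec_seq (exec_double _ _ _ _) (IH _).
Qed.

Lemma exec_pair_const e a b n x :
  exec (pair_const_cmd e) [:: a; b; n; x; 0] [:: a; b; n; cpair e x; 0].
Proof.
apply: exec_seq (exec_double _ _ _ _) _; apply: exec_seq; first exact: (exec_incr_by erefl).
by rewrite /cpair addn1; apply: exec_repeat_double.
Qed.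

Lemma exec_pair_input a b n x :
  exec pair_input_cmd [:: a; b; n; x; 0] [:: a; b; 0; cpair n x; 0].
Proof.
apply: exec_seq (exec_double _ _ _ _) _; apply: exec_seq; first exact: (exec_incr_by erefl).
rewrite /= /cpair addn1; elim: n (2 * x).+1 => [|n IH] y.
  by rewrite mul1n; apply: exec_loop0.
eapply exec_loopS_by; [reflexivity | reflexivity | exact: exec_double | cbn [set_nth]].
by rewrite /= expnSr -mulnA.
Qed.

Lemma exec_cpairs es a b n x :
  exec (cpairs_cmd es) [:: a; b; n; x; 0] [:: a; b; n; cpairs es x; 0].
Proof.
elim: es x => [|e es IH] x; first exact: exec_skip.
exact: exec_seq (exec_pair_const _ _ _ _ _) (IH _).
Qed.

Lemma exec_repeat_incr k a b n x y :
  exec (repeat_cmd k (Incr 3)) [:: a; b; n; x; y] [:: a; b; n; k + x; y].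
Proof.
elim: k x => [|k IH] x; first exact: exec_skip.
by apply: exec_seq (exec_incr _ _) _; rewrite /= addSn -addnS.
Qed.

(** The input is copied twice: register 1 counts the iterations of [cpairs es], register 2 is the
    exponent of the pairing with [n]. *)
Definition instance_cmd (es es' : seq nat) (g0 d : nat) : cmd :=
  Seq (Loop 0 (Seq (Incr 1) (Incr 2))) (Seq (repeat_cmd g0 (Incr 3))
    (Seq (Loop 1 (cpairs_cmd es)) (Seq (cpairs_cmd es')
      (Seq pair_input_cmd (pair_const_cmd d))))).

(** The shape of [enc_dl]: [d] stands for the SID, [n] for the behaviour, the rest for a formula
    with one context iterated [n] times. *)
Definition instance_code (es es' : seq nat) (g0 d n : nat) : nat :=
  cpair d (cpair n (cpairs es' (iter n (cpairs es) g0))).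

Lemma exec_instance es es' g0 d n :
  exec (instance_cmd es es' g0 d) [:: n; 0; 0; 0; 0]
    [:: 0; 0; 0; instance_code es es' g0 d n; 0].
Proof.
apply: (@exec_seq _ _ _ [:: 0; n; n; 0; 0]).
  have h k j : exec (Loop 0 (Seq (Incr 1) (Incr 2))) [:: k; j; j; 0; 0] [:: 0; k + j; k + j; 0; 0].
    elim: k j => [|k IH] j; first exact: exec_loop0.
    exec_iteration.
    by rewrite addSn -addnS.
  by have := h n 0; rewrite addn0.
apply: exec_seq (exec_repeat_incr _ _ _ _ _ _) _; rewrite addn0.
apply: (@exec_seq _ _ _ [:: 0; 0; n; iter n (cpairs es) g0; 0]).
  have h k j x : exec (Loop 1 (cpairs_cmd es)) [:: 0; k; j; x; 0] [:: 0; 0; j; iter k (cpairs es) x; 0].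
    elim: k x => [|k IH] x; first exact: exec_loop0.
    eapply exec_loopS_by; [reflexivity | reflexivity | exact: exec_cpairs | cbn [set_nth]].
    by rewrite iterSr.
  exact: h.
apply: exec_seq (exec_cpairs _ _ _ _ _) _.
exact: exec_seq (exec_pair_input _ _ _ _) (exec_pair_const _ _ _ _ _).
Qed.

Lemma exec_output x : exec (Loop 3 (Incr 0)) [:: 0; 0; 0; x; 0] [:: x; 0; 0; 0; 0].
Proof.
have h y : exec (Loop 3 (Incr 0)) [:: y; 0; 0; x; 0] [:: x + y; 0; 0; 0; 0].
  elim: x y => [|x IH] y; first exact: exec_loop0.
  by exec_iteration; rewrite addSn -addnS.
by have := h 0; rewrite addn0.
Qed.

Lemma deadlock_code_computable es es' g0 d :
  loop_computes (Seq (instance_cmd es es' g0 d) (Loop 3 (Incr 0)))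
    (instance_code es es' g0 d).
Proof. by move=> n; apply: exec_seq (exec_instance _ _ _ _ _) (exec_output _). Qed.

(** In [enc_re] the instance code is an exponent, so it is moved to register 2 and the accumulator
    restarts from [q]. *)
Definition reach_cmd es es' g0 d q : cmd :=
  Seq (instance_cmd es es' g0 d) (Seq (Loop 3 (Incr 2))
   (Seq (repeat_cmd q (Incr 3)) (Seq pair_input_cmd (Loop 3 (Incr 0))))).

Lemma reach_code_computable es es' g0 d q :
  loop_computes (reach_cmd es es' g0 d q)
    (fun n => cpair (instance_code es es' g0 d n) q).
Proof.
move=> n; apply: exec_seq (exec_instance _ _ _ _ _) _.
set x := instance_code _ _ _ _ _.
apply: (@exec_seq _ _ _ [:: 0; 0; x; 0; 0]).
  have h y : exec (Loop 3 (Incr 2)) [:: 0; 0; y; x; 0] [:: 0; 0; x + y; 0; 0].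
    elim: x y => [|k IH] y; first exact: exec_loop0.
    by exec_iteration; rewrite addSn -addnS.
  by have := h 0; rewrite addn0.
apply: exec_seq (exec_repeat_incr _ _ _ _ _ _) _; rewrite addn0.
exact: exec_seq (exec_pair_input _ _ _ _) (exec_output _).
Qed.

(* Kleene-style diagonalisation: the instance [i] that describes [diag_machine]
   applied to its own code refutes the assumed decider. *)
Lemma undecidable_by_diagonal (I : Type) (enc : I -> nat) (valid P : I -> Prop) c F :
  loop_computes c F ->
  (forall Q, 0 < size Q -> exists n i, [/\ valid i, enc i = F n & P i <-> rm_halts Q n]) ->
  ~ decidable_on enc valid P.
Proof.
move=> hc hQ [M hM].
have [|n [i [vi ei Pi]]] := hQ (diag_machine M c); first by rewrite size_diag.
have [b [hb Pb]] := hM i vi.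
rewrite ei in hb; have := diag_halts hc hb.
by case: b hb Pb; intuition; discriminate.
Qed.

(** * Simulation of a register machine by words *)

(* Rightward messages: [None] advances the register pointer of every cell,
   [Some false] increments and [Some true] decrements the register pointed to.
   Leftward messages: [false] acknowledges, [true] reports a zero register. *)
Inductive port :=
| Spin
| SendR (m : option bool) | RecvR (m : option bool)
| SendL (b : bool) | RecvL (b : bool).

Definition msg_num (m : option bool) : nat :=
  match m with None => 0 | Some false => 1 | Some true => 2 end.

Definition port_num (p : port) : nat :=
  match p with
  | Spin => 0
  | SendR m => 1 + msg_num m
  | RecvR m => 4 + msg_num m
  | SendL b => 7 + b
  | RecvL b => 9 + b
  end.

Definition port_of (n : nat) : port :=
  nth Spin [:: Spin; SendR None; SendR (Some false); SendR (Some true);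
               RecvR None; RecvR (Some false); RecvR (Some true);
               SendL false; SendL true; RecvL false; RecvL true] n.

Lemma port_numK p : port_of (port_num p) = p.
Proof. by case: p => //; case=> // -[]. Qed.

Lemma port_num_lt p : port_num p < 11.
Proof. by case: p => //; case=> // -[]. Qed.

Lemma port_ofK n : n < 11 -> port_num (port_of n) = n.
Proof. by do 11?[case: n => [//|n]]. Qed.

(* A cell [Idle l o] stores a unit of register r if [l = Some r]; its pointer [o]
   names the register to which the next increment or decrement applies. *)
Inductive cell (R N : nat) :=
| Idle (l : option 'I_R.+1) (o : 'I_R.+1)
| CarryR (m : option bool) (l : option 'I_R.+1) (o : 'I_R.+1)
| CarryL (b : bool) (l : option 'I_R.+1) (o : 'I_R.+1)
| EndIdle
| EndReply (b : bool)
| Ctl (pc : 'I_N.+1) (o : 'I_R.+1)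
| Wait (pc : 'I_N.+1) (o : 'I_R.+1)
| Halt.
Arguments Idle {R N}. Arguments CarryR {R N}. Arguments CarryL {R N}.
Arguments EndIdle {R N}. Arguments EndReply {R N}. Arguments Ctl {R N}.
Arguments Wait {R N}. Arguments Halt {R N}.

Section CellFinType.
Variables R N : nat.
Let opt := option 'I_R.+1.
Let ptr := 'I_R.+1.
Let repr := (opt * ptr + option bool * opt * ptr + bool * opt * ptr
  + option bool + ('I_N.+1 * ptr * bool) + unit)%type.

Definition cell_repr (s : cell R N) : repr :=
  match s with
  | Idle l o => inl (inl (inl (inl (inl (l, o)))))
  | CarryR m l o => inl (inl (inl (inl (inr (m, l, o)))))
  | CarryL b l o => inl (inl (inl (inr (b, l, o))))
  | EndIdle => inl (inl (inr None))
  | EndReply b => inl (inl (inr (Some b)))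
  | Ctl pc o => inl (inr (pc, o, true))
  | Wait pc o => inl (inr (pc, o, false))
  | Halt => inr tt
  end.

Definition cell_of_repr (x : repr) : cell R N :=
  match x with
  | inl (inl (inl (inl (inl (l, o))))) => Idle l o
  | inl (inl (inl (inl (inr (m, l, o))))) => CarryR m l o
  | inl (inl (inl (inr (b, l, o)))) => CarryL b l o
  | inl (inl (inr None)) => EndIdle
  | inl (inl (inr (Some b))) => EndReply b
  | inl (inr (pc, o, true)) => Ctl pc o
  | inl (inr (pc, o, false)) => Wait pc o
  | inr tt => Halt
  end.

Lemma cell_reprK : cancel cell_repr cell_of_repr.
Proof. by case. Qed.

HB.instance Definition _ := Finite.copy (cell R N) (can_type cell_reprK).
End CellFinType.

Section Words.
Variables (R : nat) (Q : seq instr).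
Let N := size Q.
Notation cell := (cell R N).
Notation ptr := 'I_R.+1.
Implicit Types (s x y : cell) (w : seq cell) (l : option ptr) (o : ptr).

Definition next_ptr o : ptr := inord (o.+1 %% R.+1).

(** All program counters beyond the program share the state [Halt]. *)
Definition control (pc : nat) o : cell := if pc < N then Ctl (inord pc) o else Halt.

Definition request (pc : nat) o : option bool :=
  let i := nth (Inc 0) Q pc in
  if ireg i == o then Some (if i is Dec _ _ then true else false) else None.

(** After a rotation the same instruction is tried again; the pointer of the controller advances in
    step with those of the cells. *)
Definition resume (pc : nat) o (b : bool) : cell :=
  let i := nth (Inc 0) Q pc in
  if ireg i == o then
    if i is Dec _ j then control (if b then j else pc.+1) o else control pc.+1 o
  else control pc (next_ptr o).

(** An increment is absorbed by a free cell, a decrement by a cell storing a unit of the current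
    register. *)
Definition hit (d : bool) l o : bool := l == if d then Some o else None.

(** The end cell acknowledges a rotation, reports zero for a decrement that no cell absorbed, and
    refuses an increment. *)
Definition delta s (p : port) : option cell :=
  match s, p with
  | Idle l o, RecvR None => Some (CarryR None l (next_ptr o))
  | Idle l o, RecvR (Some d) =>
      Some (if hit d l o then CarryL false (if d then None else Some o) o
            else CarryR (Some d) l o)
  | Idle l o, RecvL b => Some (CarryL b l o)
  | CarryR m l o, Spin => Some s
  | CarryR m l o, SendR m' => if m' == m then Some (Idle l o) else None
  | CarryL b l o, Spin => Some s
  | CarryL b l o, SendL b' => if b' == b then Some (Idle l o) else None
  | EndIdle, RecvR None => Some (EndReply false)
  | EndIdle, RecvR (Some true) => Some (EndReply true)
  | EndReply b, Spin => Some s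
  | EndReply b, SendL b' => if b' == b then Some EndIdle else None
  | Ctl pc o, Spin => Some s
  | Ctl pc o, SendR m => if m == request pc o then Some (Wait pc o) else None
  | Wait pc o, RecvL b => Some (resume pc o b)
  | _, _ => None
  end.

(** [Halt] counts as active, so that its presence excludes every other active cell. *)
Definition active s : bool :=
  match s with Idle _ _ | EndIdle | Wait _ _ => false | _ => true end.

(** * The single active cell and determinism *)

Lemma active_control pc o : active (control pc o).
Proof. by rewrite /control; case: ifP. Qed.

Lemma delta_spin s s' : delta s Spin = Some s' -> s' = s /\ s != Halt.
Proof. by case: s => //= *; split=> //; congruence. Qed.

Lemma spin_active s : active s -> s != Halt -> delta s Spin = Some s.
Proof. by case: s. Qed.

Lemma delta_sendR s m s' : delta s (SendR m) = Some s' -> active s /\ ~~ active s'.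
Proof. by case: s => //= [m' l o|pc o]; case: eqP => // _ [<-]. Qed.

Lemma delta_sendL s b s' : delta s (SendL b) = Some s' -> active s /\ ~~ active s'.
Proof. by case: s => //= [b' l o|b']; case: eqP => // _ [<-]. Qed.

Lemma delta_recvR s m s' : delta s (RecvR m) = Some s' -> ~~ active s /\ active s'.
Proof. by case: s => //= [l o|]; case: m => [[]|] // [<-] //; case: ifP. Qed.

Lemma delta_recvL s b s' : delta s (RecvL b) = Some s' -> ~~ active s /\ active s'.
Proof.
case: s => //= [l o [<-] //|pc o [<-]]; split=> //.
rewrite /resume; case: ifP => _; last exact: active_control.
by case: (nth _ _ _) => *; apply: active_control.
Qed.

(** A state offers at most one message, in one direction; with the next two lemmas this is the local
    part of determinism. *)
Lemma sendR_inj s m m' s1 s2 :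
  delta s (SendR m) = Some s1 -> delta s (SendR m') = Some s2 -> m = m'.
Proof. by case: s => //= [k l o|pc o]; do 2![case: eqP => // ->]. Qed.

Lemma sendL_inj s b b' s1 s2 :
  delta s (SendL b) = Some s1 -> delta s (SendL b') = Some s2 -> b = b'.
Proof. by case: s => //= [k l o|k]; do 2![case: eqP => // ->]. Qed.

Lemma sendRL_excl s m b s1 s2 :
  delta s (SendR m) = Some s1 -> delta s (SendL b) = Some s2 -> False.
Proof. by case: s. Qed.

(** Spinning changes no cell and is left out, which makes the relation deterministic on words with
    one active cell. *)
Inductive wstep : seq cell -> seq cell -> Prop :=
| wstep_right a x y b m x' y' :
    delta x (SendR m) = Some x' -> delta y (RecvR m) = Some y' ->
    wstep (a ++ x :: y :: b) (a ++ x' :: y' :: b)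
| wstep_left a x y b d x' y' :
    delta x (RecvL d) = Some x' -> delta y (SendL d) = Some y' ->
    wstep (a ++ x :: y :: b) (a ++ x' :: y' :: b).

Definition single_active w := count active w = 1.

(** A message hands activity over from its sender to its receiver. *)
Lemma wstep_single w w' : wstep w w' -> single_active w -> single_active w'.
Proof.
rewrite /single_active => -[a x y b m x' y'|a x y b m x' y'].
  move=> /delta_sendR [h1 /negPf h2] /delta_recvR [/negPf h3 h4].
  by rewrite !count_cat /= h1 h2 h3 h4.
move=> /delta_recvL [/negPf h1 h2] /delta_sendL [h3 /negPf h4].
by rewrite !count_cat /= h1 h2 h3 h4.
Qed.

Lemma active_split_uniq a x b a' x' b' :
  single_active (a ++ x :: b) -> active x -> active x' ->
  a ++ x :: b = a' ++ x' :: b' -> [/\ a = a', x = x' & b = b'].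
Proof.
rewrite /single_active => h hx hx'.
elim: a a' h => [|c a IH] [|c' a'] //= h [e1 e2].
- by rewrite e1 e2.
- by move: h; rewrite e2 hx count_cat /= hx'; lia.
- by move: h; rewrite e1 count_cat /= hx hx'; lia.
- rewrite e1; case: (IH a' _ e2) => [|-> -> -> //].
  by move: h; rewrite !count_cat /= hx; lia.
Qed.

(** The sender of a step is the unique active cell, and its state fixes the message and the
    direction. *)
Lemma wstep_det w w1 w2 : single_active w -> wstep w w1 -> wstep w w2 -> w1 = w2.
Proof.
move=> h s1; case: s1 h => {w w1} a x y b m x' y' hx hy h s2;
  move e: (a ++ _) s2 h => w s2; case: s2 e => {w w2} a2 x2 y2 b2 m2 x2' y2' hx2 hy2 e h; rewrite -e in h.
- have [-> ? [? ->]] := active_split_uniq h (delta_sendR hx).1 (delta_sendR hx2).1 e.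
  subst; have ? := sendR_inj hx hx2; subst; congruence.
(* In a leftward step the sender is the second cell; regrouping makes it the point where the word is
   split. *)
- rewrite -!(cat_rcons x2) in e h *.
  have [_ ? _] := active_split_uniq h (delta_sendR hx).1 (delta_sendL hy2).1 e.
  by subst; case: (sendRL_excl hx hy2).
- rewrite -!(cat_rcons x) in e h.
  have [_ ? _] := active_split_uniq h (delta_sendL hy).1 (delta_sendR hx2).1 e.
  by subst; case: (sendRL_excl hx2 hy).
- rewrite -!(cat_rcons x) -(cat_rcons x2) in e h.
  have [/rcons_inj [-> ?] ? ->] := active_split_uniq h (delta_sendL hy).1 (delta_sendL hy2).1 e.
  subst; have ? := sendL_inj hy hy2; subst; congruence.
Qed.

Definition stuck w := forall w', ~ wstep w w'.

Lemma active_mem_uniq w x y :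
  single_active w -> x \in w -> y \in w -> active x -> active y -> x = y.
Proof.
have split z : z \in w -> exists a b, w = a ++ z :: b by case/splitPr=> a b; exists a, b.
move=> h /split [a [b ex]] /split [a' [b' ey]] hx hy.
by rewrite ex in h ey; have [] := active_split_uniq h hx hy ey.
Qed.

Lemma halted_stuck w : single_active w -> Halt \in w -> stuck w.
Proof.
move=> h hH w' s; case: s h hH => {w w'} a x y b m x' y' hx hy h hH.
  have [ax _] := delta_sendR hx.
  have := active_mem_uniq h hH _ isT ax.
  by rewrite mem_cat inE eqxx orbT => /(_ isT) e; rewrite -e in hx.
have [ay _] := delta_sendL hy.
have := active_mem_uniq h hH _ isT ay.
by rewrite mem_cat !inE eqxx !orbT => /(_ isT) e; rewrite -e in hy.
Qed.

Fixpoint nsteps (n : nat) w w' : Prop :=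
  if n is k.+1 then exists2 v, wstep w v & nsteps k v w' else w = w'.

Lemma nsteps_cat n k u v w : nsteps n u v -> nsteps k v w -> nsteps (n + k) u w.
Proof. by elim: n u => [|n IH] u /= => [-> //|[x s h] h']; exists x => //; apply: IH. Qed.

Lemma nsteps_single n u v : nsteps n u v -> single_active u -> single_active v.
Proof. by elim: n u => [|n IH] u /= => [-> //|[x s h] /(wstep_single s)]; apply: IH. Qed.

(** By determinism every run is a prefix of the one that ends in a stuck word. *)
Lemma nsteps_stuck n k u v w : single_active u -> stuck w ->
  nsteps n u w -> nsteps k u v -> k <= n /\ nsteps (n - k) v w.
Proof.
move=> h hw; elim: k n u h => [|k IH] n u h; first by rewrite subn0 => ? <-.
case: n => [/= -> [x /hw //]|n].
move=> [x s1 h1] [y s2 h2]; rewrite (wstep_det h s2 s1) in h2.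
by have [] := IH _ _ (wstep_single s1 h) h1 h2.
Qed.

Definition reaches u v := exists n, nsteps n u v.
(** Strictness makes the number of remaining steps drop in [simulation_sound]. *)
Definition reaches_plus u v := exists n, nsteps n.+1 u v.

Lemma reaches_step u v w : wstep u v -> reaches v w -> reaches_plus u w.
Proof. by move=> s [n h]; exists n; exists v. Qed.

Lemma reaches_refl u : reaches u u. Proof. by exists 0. Qed.

Lemma reaches_plusW u v : reaches_plus u v -> reaches u v.
Proof. by case=> n; exists n.+1. Qed.

Lemma reaches_trans v u w : reaches u v -> reaches v w -> reaches u w.
Proof. by move=> [n h1] [k h2]; exists (n + k); apply: nsteps_cat h1 h2. Qed.

Lemma reaches_plus_trans v u w : reaches u v -> reaches_plus v w -> reaches_plus u w.
Proof. by move=> [n h1] [k h2]; exists (n + k); rewrite -addnS; apply: nsteps_cat h1 h2. Qed.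

(** * Messages sweeping along the chain *)

Definition idles o (ls : seq (option ptr)) : seq cell := [seq Idle l o | l <- ls].

Lemma sweep_rotate a t t' o ls : delta t (SendR None) = Some t' ->
  reaches_plus (a ++ t :: idles o ls ++ [:: EndIdle])
    (a ++ t' :: idles (next_ptr o) ls ++ [:: EndReply false]).
Proof.
elim: ls a t t' => [|l ls IH] a t t' ht /=.
  by apply: reaches_step (reaches_refl _); apply: (wstep_right _ _ ht).
apply: reaches_step; first exact: (wstep_right _ _ ht (y' := CarryR None l (next_ptr o))).
rewrite -(cat_rcons t' a) -(cat_rcons t' a).
by apply: reaches_plusW; apply: IH.
Qed.

(** The run stops just before the message is delivered to [b], with [s] as its current sender. The
    receiver stays open, so the lemma serves for a hit, a zero report and an overflow. *)
Lemma sweep_miss a t t' d o ls b : delta t (SendR (Some d)) = Some t' ->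
  ~~ has (hit d ^~ o) ls -> exists a' s s',
  [/\ reaches (a ++ t :: idles o ls ++ b) (a' ++ s :: b), delta s (SendR (Some d)) = Some s'
    & rcons a' s' = a ++ t' :: idles o ls].
Proof.
elim: ls a t t' => [|l ls IH] a t t' ht /=.
  by exists a, t, t'; split; rewrite ?cats1 //; exact: reaches_refl.
rewrite negb_or => /andP[hl hls].
have [] := IH (rcons a t') (CarryR (Some d) l o) (Idle l o) _ hls; first by rewrite /= eqxx.
move=> a' [s [s' [h1 h2 h3]]]; exists a', s, s'; split=> //; last by rewrite h3 cat_rcons.
apply: reaches_trans h1; rewrite cat_rcons; apply: reaches_plusW.
apply: reaches_step (reaches_refl _); apply: (wstep_right _ _ ht).
by rewrite /= (negPf hl).
Qed.

Lemma sweep_hit a t t' d o ls l b : delta t (SendR (Some d)) = Some t' ->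
  ~~ has (hit d ^~ o) ls -> hit d l o ->
  reaches (a ++ t :: idles o ls ++ Idle l o :: b)
    (a ++ t' :: idles o ls ++ CarryL false (if d then None else Some o) o :: b).
Proof.
move=> ht h1 h2.
have [a' [s [s' [h3 h4 h5]]]] := sweep_miss a (Idle l o :: b) ht h1.
apply: reaches_trans h3 _; rewrite -[X in reaches _ X]/((a ++ (t' :: idles o ls) ++ _)).
rewrite [a ++ _]catA -h5 cat_rcons; apply: reaches_plusW.
apply: reaches_step (reaches_refl _); apply: (wstep_right _ _ h4).
by rewrite /= h2.
Qed.

(** The reply moves left, so the induction removes cells at the right end. *)
Lemma sweep_back c c' t t' d o ls b : delta t (SendL d) = Some t' ->
  delta c (RecvL d) = Some c' ->
  reaches_plus (c :: idles o ls ++ t :: b) (c' :: idles o ls ++ t' :: b).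
Proof.
move=> ht hc; elim/last_ind: ls t t' b ht => [|ls l IH] t t' b ht /=.
  by apply: reaches_step (reaches_refl _); apply: (wstep_left [::] b hc ht).
rewrite /idles map_rcons !cat_rcons -/(idles o ls).
apply: (@reaches_step _ (c :: idles o ls ++ CarryL d l o :: t' :: b)).
  by apply: (wstep_left (c :: idles o ls) b _ ht).
by apply: reaches_plusW; apply: IH; rewrite /= eqxx.
Qed.

Definition world (pc : nat) o ls : seq cell := control pc o :: idles o ls ++ [:: EndIdle].

Lemma world_single pc o ls : single_active (world pc o ls).
Proof.
rewrite /single_active /world /= active_control count_cat /=.
suff -> : count active (idles o ls) = 0 by [].
by elim: ls.
Qed.

Section Running.
Variable pc : nat.
Hypothesis pc_lt : pc < N.

Lemma control_send o : exists2 c, delta (control pc o) (SendR (request pc o)) = Some c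
  & forall b, delta c (RecvL b) = Some (resume pc o b).
Proof.
have e : (inord pc : 'I_N.+1) = pc :> nat by rewrite inordK // ltnS ltnW.
by rewrite /control pc_lt /= e eqxx; exists (Wait (inord pc) o) => //= b; rewrite e.
Qed.

Lemma run_rotate o ls : ireg (nth (Inc 0) Q pc) != o ->
  reaches_plus (world pc o ls) (world pc (next_ptr o) ls).
Proof.
move=> ne; have [c h1 h2] := control_send o.
have er : request pc o = None by rewrite /request (negPf ne).
rewrite er in h1; apply: (reaches_plus_trans (reaches_plusW (sweep_rotate [::] o ls h1))).
have := h2 false; rewrite /resume (negPf ne) => h3.
by apply: sweep_back h3; rewrite /=.
Qed.

Lemma run_hit o ls1 l ls2 d : ireg (nth (Inc 0) Q pc) = o ->
  request pc o = Some d -> ~~ has (hit d ^~ o) ls1 -> hit d l o ->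
  reaches_plus (world pc o (ls1 ++ l :: ls2))
   (resume pc o false :: idles o (ls1 ++ (if d then None else Some o) :: ls2) ++ [:: EndIdle]).
Proof.
move=> e hr h1 h2; have [c h3 h4] := control_send o; rewrite hr in h3.
rewrite /world /idles !map_cat /= -/(idles o ls1) -/(idles o ls2) -!catA.
apply: reaches_plus_trans (sweep_hit [::] _ h3 h1 h2) _ => /=.
by apply: sweep_back (h4 false); rewrite /=.
Qed.

Lemma run_zero o ls : ireg (nth (Inc 0) Q pc) = o ->
  request pc o = Some true -> Some o \notin ls ->
  reaches_plus (world pc o ls) (resume pc o true :: idles o ls ++ [:: EndIdle]).
Proof.
move=> e hr h1; have [c h3 h4] := control_send o; rewrite hr in h3.
have h1' : ~~ has (hit true ^~ o) ls by rewrite has_pred1.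
have [a' [s [s' [h5 h6 h7]]]] := sweep_miss [::] [:: EndIdle] h3 h1'.
apply: reaches_plus_trans h5 _.
apply: (@reaches_step _ (c :: idles o ls ++ [:: EndReply true])).
  rewrite -[c :: _]/(([::] ++ c :: idles o ls) ++ [:: EndReply true]) -h7 cat_rcons.
  exact: (wstep_right _ _ h6).
by apply: reaches_plusW; apply: sweep_back (h4 true); rewrite /=.
Qed.

(* An increment that finds no free cell blocks in front of the last cell. *)
Lemma run_overflow o ls : request pc o = Some false -> None \notin ls ->
  exists v, [/\ reaches (world pc o ls) v, stuck v & Halt \notin v].
Proof.
move=> hr h1; have [c h3 h4] := control_send o; rewrite hr in h3.
have h1' : ~~ has (hit false ^~ o) ls by rewrite has_pred1.
have [a' [s [s' [h5 h6 h7]]]] := sweep_miss [::] [:: EndIdle] h3 h1'.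
exists (a' ++ [:: s; EndIdle]); split=> //.
  have [n h5'] := h5; have hv := nsteps_single h5' (world_single pc o ls).
  move=> w st; move e: (_ ++ _) st hv => v st; case: st e => {v w} a x y b m x' y' hx hy e hv.
    have [as_ _] := delta_sendR h6; have [ax _] := delta_sendR hx.
    rewrite -e in hv; have [_ ? [? _]] := active_split_uniq hv as_ ax e; subst.
    by have ? := sendR_inj h6 hx; subst.
  have [as_ _] := delta_sendR h6; have [ay _] := delta_sendL hy.
  rewrite -e in hv; rewrite -(cat_rcons x) in e.
  have [_ ? _] := active_split_uniq hv as_ ay e; subst.
  exact: (sendRL_excl h6 hy).
have [n h5'] := h5; have hv := nsteps_single h5' (world_single pc o ls).
apply/negP => hH; have [as_ _] := delta_sendR h6.
have := active_mem_uniq hv hH _ isT as_.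
by rewrite mem_cat inE eqxx orbT => /(_ isT) es; rewrite -es in h6.
Qed.

End Running.

(** * Simulation of the register machine *)

Definition counts (f : regs) ls := forall r : ptr, f r = count_mem (Some r) ls.

Hypothesis regs_lt : forall pc, pc < N -> ireg (nth (Inc 0) Q pc) < R.+1.

Lemma iter_next_ptr k o : iter k next_ptr o = (o + k) %% R.+1 :> nat.
Proof.
elim: k => [|k IH] /=; first by rewrite addn0 modn_small.
by rewrite /next_ptr inordK ?ltn_mod // IH -addn1 modnDml addn1 addnS.
Qed.

Lemma run_select pc o (r : ptr) ls : pc < N -> ireg (nth (Inc 0) Q pc) = r :> nat ->
  reaches (world pc o ls) (world pc r ls).
Proof.
move=> lt er.
have h k : iter k next_ptr o = r -> reaches (world pc o ls) (world pc r ls).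
  elim: k o => [|k IH] o'; first by move=> /= ->; apply: reaches_refl.
  (* At pointer [r] the controller no longer rotates, so the remaining rotations are dropped. *)
  rewrite iterSr; case: (eqVneq o' r) => [-> _|ne e]; first exact: reaches_refl.
  apply: reaches_trans (IH _ e); apply: reaches_plusW; apply: run_rotate => //.
  by apply: contra ne => /eqP e1; apply/eqP/val_inj; rewrite /= -e1.
(* [R.+1 - o] rotations bring the pointer to 0, and [r] more bring it to [r]. *)
apply: (h (R.+1 - o + r)); apply: val_inj; rewrite /= iter_next_ptr addnA subnKC 1?ltnW //.
by rewrite modnDl modn_small.
Qed.

Lemma split_miss (P : pred (option ptr)) ls : has P ls ->
  exists ls1 l ls2, [/\ ls = ls1 ++ l :: ls2, ~~ has P ls1 & P l].
Proof.
elim: ls => //= l ls IH; case hl: (P l) => /=.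
  by move=> _; exists [::], l, ls.
by case/IH=> ls1 [l' [ls2 [-> h1 h2]]]; exists (l :: ls1), l', ls2; rewrite /= hl.
Qed.

(** The pointer is rotated to the register of the instruction, then one request is served. A step
    uses up at most one free cell; only an increment without a free cell leads to the second
    alternative. *)
Lemma simulate_step pc f o ls : pc < N -> counts f ls ->
  let cf := rm_step Q (pc, f) in
  (exists o' ls', [/\ reaches_plus (world pc o ls) (world cf.1 o' ls'), counts cf.2 ls'
     & count_mem None ls <= (count_mem None ls').+1]) \/
  None \notin ls /\ exists v, [/\ reaches (world pc o ls) v, stuck v & Halt \notin v].
Proof.
move=> lt hf; rewrite /rm_step -/N leqNgt lt /=.
pose r := Ordinal (regs_lt lt).
have hs : reaches (world pc o ls) (world pc r ls) by apply: run_select.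
have hreq : request pc r = Some (if nth (Inc 0) Q pc is Dec _ _ then true else false).
  by rewrite /request eqxx.
have hres b : resume pc r b =
    if nth (Inc 0) Q pc is Dec _ j then control (if b then j else pc.+1) r else control pc.+1 r.
  by rewrite /resume eqxx.
have erf : ireg (nth (Inc 0) Q pc) = r :> nat by [].
have reach_world P : reaches_plus (world pc r ls) P -> reaches_plus (world pc o ls) P.
  exact: reaches_plus_trans hs.
clearbody r; case ei: (nth (Inc 0) Q pc) => [q|q j] in hreq hres erf *; rewrite /= in erf; subst q.
- case hn: (None \in ls); last first.
    right; split=> //.
    have [v [h1 h2 h3]] := run_overflow lt hreq (negbT hn).
    by exists v; split=> //; apply: reaches_trans hs h1.
  left; exists r.
  have [] := @split_miss (hit false ^~ r) ls; first by rewrite has_pred1.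
  move=> ls1 [l [ls2 [els h1 h2]]].
  exists (ls1 ++ Some r :: ls2); split=> /=.
  + apply: reach_world; rewrite els.
    have := run_hit lt ls2 _ hreq h1 h2.
    by rewrite hres ei; apply.
  + move=> r'; rewrite /rupd els in hf *; rewrite (eqP h2) in hf; have := hf r'.
    rewrite !count_cat /=; case: (eqVneq (r' : nat) r) => [/val_inj ->|ne]; last first.
      by move=> ->; case: eqP => // -[e]; rewrite e eqxx in ne.
    by rewrite eqxx /= => ->; rewrite addnS.
  + by rewrite els !count_cat /= (eqP h2); case: (_ == _) => /=; lia.
- have hfr := hf r; case efr: (f r) => [|k]; left; exists r.
    exists ls; split=> //; apply: reach_world.
    have := run_zero lt (o := r) _ hreq (ls := ls); rewrite hres ei /=; apply=> //.
    by rewrite -has_pred1 has_count -hfr efr.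
  have [] := @split_miss (hit true ^~ r) ls; first by rewrite has_count -hfr efr.
  move=> ls1 [l [ls2 [els h1 h2]]].
  exists (ls1 ++ None :: ls2); split=> /=.
  + apply: reach_world; rewrite els.
    have := run_hit lt ls2 _ hreq h1 h2.
    by rewrite hres ei; apply.
  + move=> r'; rewrite /rupd els in hf *; rewrite (eqP h2) in hf; have := hf r'.
    rewrite !count_cat /=; case: (eqVneq (r' : nat) r) => [/val_inj ->|ne]; last first.
      move=> ->; case: eqP => // -[e]; by rewrite e eqxx in ne.
    by rewrite efr eqxx /=; lia.
  + by rewrite els !count_cat /= (eqP h2) /=; lia.
Qed.

(** Strong induction on the length of the run: a word with [Halt] is stuck, so by determinism the
    run passes through the word of the next machine configuration. *)
Lemma simulation_sound n pc f o ls w : counts f ls -> nsteps n (world pc o ls) w ->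
  Halt \in w -> exists k, N <= (iter k (rm_step Q) (pc, f)).1.
Proof.
have [m] := ubnP n; elim: m n pc f o ls => // m IH n pc f o ls; rewrite ltnS => lenm hf hn hx.
case: (leqP N pc) => lt; first by exists 0.
have hw := world_single pc o ls.
have hsx : stuck w by apply: halted_stuck hx; apply: nsteps_single hn hw.
case: (simulate_step o lt hf) => [[o' [ls' [[k hk] hf' _]]]|[_ [v [[k hk] hv /negP[]]]]].
  have [le hn'] := nsteps_stuck hw hsx hn hk.
  have [|k' hk'] := IH (n - k.+1) (rm_step Q (pc, f)).1 (rm_step Q (pc, f)).2 o' ls' _ hf' hn' hx.
    by lia.
  by exists k'.+1; rewrite iterSr; move: hk'; rewrite -surjective_pairing.
(* After an overflow the run could only end in the stuck word [v], which lacks [Halt]. *)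
have [_] := nsteps_stuck hw hsx hn hk.
by case: (n - k) => [-> //|j [y /hv]].
Qed.

(** Each machine step uses at most one free cell, so [k] of them rule out an overflow during [k]
    steps. *)
Lemma simulation_complete k pc f o ls : counts f ls -> k <= count_mem None ls ->
  N <= (iter k (rm_step Q) (pc, f)).1 ->
  exists2 w, reaches (world pc o ls) w & Halt \in w.
Proof.
elim: k pc f o ls => [|k IH] pc f o ls hf hk.
  move=> /= h; exists (world pc o ls); first exact: reaches_refl.
  by rewrite /world /control ltnNge h inE eqxx.
case: (leqP N pc) => lt.
  move=> _; exists (world pc o ls); first exact: reaches_refl.
  by rewrite /world /control ltnNge lt inE eqxx.
rewrite iterSr; case: (simulate_step o lt hf) => [[o' [ls' [h1 hf' h2]]]|[h _]]; last first.
  by move: hk; rewrite (count_memPn h).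
move=> hN; have [||x hx1 hx2] := IH (rm_step Q (pc, f)).1 (rm_step Q (pc, f)).2 o' ls' hf' _.
- by lia.
- by rewrite -surjective_pairing.
by exists x => //; apply: reaches_trans (reaches_plusW h1) hx1.
Qed.

End Words.

(** * From words to Petri nets *)

(* The binary types pair a send with the matching receive, see [port_num]. *)
Definition chain_sig : signature :=
  Signature 11 [:: [:: 0]; [:: 1; 4]; [:: 2; 5]; [:: 3; 6]; [:: 9; 7]; [:: 10; 8]].

Lemma chain_sig_ok : sig_ok_12 chain_sig.
Proof.
split; first exact/allP.
have /allP h : all (all (gtn 11)) (sig_inter chain_sig) by [].
by move=> ps p /h /allP; apply.
Qed.

(** The constants are those of [chain_sig]: type 0 is unary, types 1 to 5 are binary and join
    neighbours. *)
Fixpoint linked (us : seq nat) (i : nat) (t : seq nat) : bool :=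
  if us is u :: us' then
    [|| (i == 0) && (t == [:: u]),
        (if us' is v :: _ then (0 < i < 6) && (t == [:: u; v]) else false) |
        linked us' i t]
  else false.

Lemma linked_catr a b i t : linked b i t -> linked (a ++ b) i t.
Proof. by move=> h; elim: a => //= x a ->; rewrite !orbT. Qed.

Lemma linkedP us i t : linked us i t ->
  (exists a u b, [/\ i = 0, us = a ++ u :: b & t = [:: u]]) \/
  (exists a u v b, [/\ 0 < i < 6, us = a ++ u :: v :: b & t = [:: u; v]]).
Proof.
elim: us => //= u us IH /or3P[/andP[/eqP -> /eqP ->]||/IH].
- by left; exists [::], u, us.
- by case: us {IH} => //= v us /andP[hi /eqP ->]; right; exists [::], u, v, us.
- case=> [[a [x [b [-> -> ->]]]]|[a [x [v [b [hi -> ->]]]]]]; [left|right].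
    by exists (u :: a), x, b.
  by exists (u :: a), x, v, b.
Qed.

Lemma unzip1_uniq_inj (T : eqType) (W : seq (nat * T)) u s s' :
  uniq (unzip1 W) -> (u, s) \in W -> (u, s') \in W -> s = s'.
Proof.
elim: W => //= -[v x] W IH /= /andP[hv hW]; rewrite !inE.
have nv y : (u, y) \in W -> u != v.
  by move=> h; apply: contraNneq hv => <-; exact: (map_f fst h).
case/orP=> [/eqP[e1 e2]|h1] /orP[/eqP[e3 e4]|h2]; first by rewrite e2 e4.
- by have := nv _ h2; rewrite e1 eqxx.
- by have := nv _ h1; rewrite e3 eqxx.
- exact: IH.
Qed.

Section Net.
Variables (R : nat) (Q : seq instr).
Notation cell := (cell R (size Q)).
Notation delta := (@delta R Q).
Notation wstep := (@wstep R Q).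
Implicit Types W : seq (nat * cell).

(* The formulas of the reduction mention the numbers 0 .. 4 of these states. *)
Definition cells : seq cell :=
  [:: Idle None ord0; Idle (Some ord0) ord0; EndIdle; Ctl ord0 ord0; Halt] ++ enum {: cell}.

(** [cells] repeats some states; [index] takes the first occurrence, which keeps the codes injective
    and gives the five states listed first the numbers 0 to 4. *)
Definition code (s : cell) : nat := index s cells.

Lemma mem_cells s : s \in cells.
Proof. by rewrite mem_cat mem_enum orbT. Qed.

Lemma code_lt s : code s < size cells.
Proof. by rewrite index_mem mem_cells. Qed.

Lemma code_inj : injective code.
Proof. by move=> s s' h; rewrite -(nth_index Halt (mem_cells s)) -/(code s) h nth_index ?mem_cells. Qed.

Definition moves : seq (nat * nat * nat) :=
  flatten [seq pmap (fun p => omap (fun s' => (code s, p, code s')) (delta s (port_of p)))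
             (iota 0 11) | s <- enum {: cell}].

Definition chain_beh : behavior := Behavior (size cells) moves.

Lemma movesP t : reflect (exists s p s', t = (code s, port_num p, code s') /\ delta s p = Some s')
  (t \in moves).
Proof.
apply: (iffP flatten_mapP) => [[s _]|[s [p [s' [-> h]]]]]; last first.
  exists s; rewrite ?mem_enum // mem_pmap; apply/mapP; exists (port_num p).
    by rewrite mem_iota port_num_lt.
  by rewrite port_numK h.
rewrite mem_pmap => /mapP[p]; rewrite mem_iota /= => hp.
case hd: (delta s (port_of p)) => [s'|] //= [->].
by exists s, (port_of p), s'; rewrite port_ofK.
Qed.

Lemma moves_delta p s s' : delta s p = Some s' -> (code s, port_num p, code s') \in moves.
Proof. by move=> h; apply/movesP; exists s, p, s'. Qed.

Lemma chain_beh_wf : beh_wf chain_sig chain_beh.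
Proof.
by move=> t /movesP[s [p [s' [-> _]]]] /=; rewrite !code_lt port_num_lt.
Qed.

(** [W] lists the chain in order: first projections are the components, second projections form the
    word. *)
Definition encodes (m : marking) W :=
  forall q u, m q u <-> exists2 s, (u, s) \in W & q = code s.

Lemma encodes_inj m W s u : uniq (unzip1 W) -> encodes m W ->
  m (code s) u -> forall s', (u, s') \in W -> s' = s.
Proof. by move=> hu hm /hm[x hx /code_inj ->] s' h; apply: unzip1_uniq_inj hu h hx. Qed.

Lemma pre1 i u t q w : pre (PTrans i [:: u] [:: t]) q w <-> q = t.1.1 /\ w = u.
Proof. by split=> [[[|j]] //|[-> ->]]; exists 0. Qed.

Lemma post1 i u t q w : post (PTrans i [:: u] [:: t]) q w <-> q = t.2 /\ w = u.
Proof. by split=> [[[|j]] //|[-> ->]]; exists 0. Qed.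

Lemma pre2 i u v t1 t2 q w : pre (PTrans i [:: u; v] [:: t1; t2]) q w <->
  q = t1.1.1 /\ w = u \/ q = t2.1.1 /\ w = v.
Proof.
split=> [[[|[|j]]] // _ /= [-> ->]|[[-> ->]|[-> ->]]]; [by left|by right|by exists 0|by exists 1].
Qed.

Lemma post2 i u v t1 t2 q w : post (PTrans i [:: u; v] [:: t1; t2]) q w <->
  q = t1.2 /\ w = u \/ q = t2.2 /\ w = v.
Proof.
split=> [[[|[|j]]] // _ /= [-> ->]|[[-> ->]|[-> ->]]]; [by left|by right|by exists 0|by exists 1].
Qed.

(** As indices are pairwise distinct, removing the pre-set removes exactly the entries of [u] and
    [v]. *)
Lemma fires_encodes A u x v y B x' y' i p p' m m' :
  let t := PTrans i [:: u; v] [:: (code x, p, code x'); (code y, p', code y')] in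
  uniq (unzip1 (A ++ (u, x) :: (v, y) :: B)) ->
  encodes m (A ++ (u, x) :: (v, y) :: B) ->
  (forall q w, m' q w <-> (m q w /\ ~ pre t q w) \/ post t q w) ->
  encodes m' (A ++ (u, x') :: (v, y') :: B).
Proof.
move=> t hu hm hm' q w; rewrite hm' pre2 post2 hm /=.
have fr s : (w, s) \in A ++ B -> w <> u /\ w <> v.
  rewrite mem_cat => h; have {h} : (w \in map fst A) || (w \in map fst B).
    by case/orP: h => h; rewrite (map_f fst h) ?orbT.
  move: hu; rewrite /unzip1 map_cat cat_uniq /= !inE !negb_or.
  case/and3P=> _ /and3P[ua va _] /and3P[/andP[_ ub] vb _] h.
  by split=> e; subst w; move: h; rewrite ?(negPf ua) ?(negPf ub) ?(negPf va) ?(negPf vb).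
split=> [[[[s hs ->] hn]|[[-> ->]|[-> ->]]]|[s]].
- exists s => //; move: hs hn; rewrite !mem_cat !inE => /orP[->//|/or3P[]].
  + by move=> /eqP[-> ->] []; left.
  + by move=> /eqP[-> ->] []; right.
  + by move=> ->; rewrite !orbT.
- by exists x' => //; rewrite mem_cat !inE eqxx orbT.
- by exists y' => //; rewrite mem_cat !inE eqxx !orbT.
rewrite mem_cat !inE => /orP[h|/or3P[/eqP[-> ->]|/eqP[-> ->]|h]] ->; auto; left.
  have [] := fr s; first by rewrite mem_cat h.
  by move=> ? ?; split; [exists s => //; rewrite mem_cat h|case=> -[_ ?]].
have [] := fr s; first by rewrite mem_cat h orbT.
by move=> ? ?; split; [exists s => //; rewrite mem_cat !inE h !orbT|case=> -[_ ?]].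
Qed.

Variables (c : config) (us : seq nat).
Hypothesis us_uniq : uniq us.
Hypothesis inter_linked : forall i t, cinter c i t <-> linked us i t.

Notation is_trans := (is_trans chain_sig chain_beh c).

Lemma spin_trans s u : delta s Spin = Some s -> u \in us ->
  is_trans (PTrans 0 [:: u] [:: (code s, 0, code s)]).
Proof.
move=> hs hu; split=> //=.
  by apply/inter_linked; case/splitPr: hu => a b; apply: linked_catr; rewrite /= !eqxx.
by case=> //= _; split=> //; apply: (moves_delta hs).
Qed.

Lemma pair_trans i a u x v y b p p' x' y' : us = a ++ u :: v :: b ->
  inter_ports chain_sig i = [:: port_num p; port_num p'] ->
  delta x p = Some x' -> delta y p' = Some y' ->
  is_trans (PTrans i [:: u; v] [:: (code x, port_num p, code x'); (code y, port_num p', code y')]).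
Proof.
move=> eus hi hx hy.
have i6 : 0 < i < 6 by move: hi; case: i => [|[|[|[|[|[|i]]]]]] //=; rewrite /inter_ports /= nth_nil.
split; rewrite /arity ?hi //=.
- by case/andP: i6.
- apply/inter_linked; rewrite eus; apply: linked_catr; rewrite /= i6 !eqxx /=.
  by rewrite orbT.
- by case=> [|[|j]] //= _; split=> //; apply: moves_delta.
- move: us_uniq; rewrite eus cat_uniq /= => /and3P[_ _].
  by rewrite !inE !negb_or => /andP[/andP[-> _] _].
Qed.

Lemma map_split (T U : Type) (f : T -> U) (s : seq T) a b : map f s = a ++ b ->
  exists s1 s2, [/\ s = s1 ++ s2, map f s1 = a & map f s2 = b].
Proof.
move=> h; exists (take (size a) s), (drop (size a) s).
by rewrite cat_take_drop map_take map_drop h take_size_cat // drop_size_cat.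
Qed.

Lemma net_step W w' m : unzip1 W = us -> encodes m W -> wstep (unzip2 W) w' ->
  exists t m' W', [/\ is_trans t, fires t m m', encodes m' W', unzip1 W' = us & unzip2 W' = w'].
Proof.
move=> eus hm; move ew: (unzip2 W) => w st.
have main i a x y b p p' x' y' : inter_ports chain_sig i = [:: port_num p; port_num p'] ->
  delta x p = Some x' -> delta y p' = Some y' -> unzip2 W = a ++ x :: y :: b ->
  exists t m' W', [/\ is_trans t, fires t m m', encodes m' W', unzip1 W' = us
     & unzip2 W' = a ++ x' :: y' :: b].
  move=> hi hx hy /map_split[A [B0 [eW eA]]].
  case: B0 eW => [//|[u x0] [//|[v y0] B]] eW [/= ex ey eB]; subst x0 y0.
  have eus' : us = unzip1 A ++ u :: v :: unzip1 B by rewrite -eus eW /unzip1 map_cat.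
  have ht := pair_trans eus' hi hx hy; move: ht; set t := PTrans _ _ _ => ht.
  exists t, (fun q w => (m q w /\ ~ pre t q w) \/ post t q w).
  exists (A ++ (u, x') :: (v, y') :: B); split=> //.
  - split=> // q u0 /pre2 /= [[-> ->]|[-> ->]]; apply/hm.
      by exists x => //; rewrite eW mem_cat !inE eqxx orbT.
    by exists y => //; rewrite eW mem_cat !inE eqxx !orbT.
  - by apply: (@fires_encodes A u x v y B x' y' i (port_num p) (port_num p') m); rewrite -?eW ?eus.
  - by rewrite eus' /unzip1 map_cat.
  - by rewrite -eA -eB /unzip2 map_cat.
(* The message determines the binary interaction type. *)
case: st ew => {w w'} a x y b; [case=> [[]|]|case] => x' y' hx hy ew.
- exact: (main 3) hx hy ew.
- exact: (main 2) hx hy ew.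
- exact: (main 1) hx hy ew.
- exact: (main 5) hx hy ew.
- exact: (main 4) hx hy ew.
Qed.

(** The successor is given by its defining equivalence instead of [fires], so that [dead_encodes]
    can apply the lemma to an enabled transition alone. *)
Lemma step_net W m m' t : unzip1 W = us -> encodes m W -> is_trans t -> enabled t m ->
  (forall q u, m' q u <-> (m q u /\ ~ pre t q u) \/ post t q u) ->
  exists W', [/\ unzip1 W' = us, encodes m' W' &
    (exists2 s, s \in unzip2 W & delta s Spin = Some s) /\ W' = W \/ wstep (unzip2 W) (unzip2 W')].
Proof.
case: t => i us' ts eus hm [/= hi hc [sz1 sz2] htr hun] hen hm'.
have hW : uniq (unzip1 W) by rewrite eus.
move/inter_linked: hc => /linkedP [[a [u [b [ei eu eus']]]]|[a [u [v [b [i6 eu eus']]]]]]; subst us'.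
  subst i; case: ts sz2 htr hen hm' => [//|[[q p] q'] [|//]] _ htr hen hm'.
  have [/= /movesP[s [p0 [s' [[e1 e2 e3] hd]]]] e4] := htr 0 isT.
  have ep : p0 = Spin by rewrite -(port_numK p0) -e2 e4.
  subst p0; have [es _] := delta_spin hd; subst s' q q' p.
  have hmu : m (code s) u by apply: hen; apply/pre1.
  exists W; split=> //; last first.
    by left; split=> //; exists s => //; case/hm: hmu => x hx /code_inj ->; exact: (map_f snd hx).
  move=> q w; rewrite hm' pre1 post1 -hm /=; split=> [[[]//|[-> ->]//]|h].
  case: (q =P code s) => [e|ne]; last by left; split=> // -[].
  by case: (w =P u) => [ew|ne]; [right|left; split=> // -[]].
rewrite -eus in eu; case/map_split: eu => A [B0 [eW eA]].
case: B0 eW => [//|[u0 x] [//|[v0 y] B]] eW [/= eu0 ev0 eB].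
subst u0 v0.
have ar2 : size ts = 2 by rewrite sz2 -sz1.
case: ts ar2 {sz1 sz2} htr hen hm' => [//|[[q1 p1] q1'] [//|[[q2 p2] q2'] [|//]]] _ htr hen hm'.
have [/= /movesP[s1 [p1' [s1' [[e1 e2 e3] hd1]]]] e4] := htr 0 isT.
have [/= /movesP[s2 [p2' [s2' [[e5 e6 e7] hd2]]]] e8] := htr 1 isT.
subst q1 q1' q2 q2' p1 p2.
have es1 : x = s1.
  apply: (encodes_inj hW hm (u := u)); first by apply: hen; apply/pre2; left.
  by rewrite eW mem_cat !inE eqxx orbT.
have es2 : y = s2.
  apply: (encodes_inj hW hm (u := v)); first by apply: hen; apply/pre2; right.
  by rewrite eW mem_cat !inE eqxx !orbT.
subst s1 s2.
exists (A ++ (u, s1') :: (v, s2') :: B); split.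
- by rewrite -eus eW /unzip1 !map_cat.
- by apply: fires_encodes hm'; rewrite -?eW ?eus.
right; rewrite eW /unzip2 !map_cat /=.
have right m0 : port_num p1' = port_num (SendR m0) -> port_num p2' = port_num (RecvR m0) ->
  wstep ([seq i.2 | i <- A] ++ [:: x, y & [seq i.2 | i <- B]]) ([seq i.2 | i <- A] ++ [:: s1', s2' & [seq i.2 | i <- B]]).
  move=> /(congr1 port_of); rewrite !port_numK => h1 /(congr1 port_of); rewrite !port_numK => h2.
  by subst; apply: wstep_right hd1 hd2.
have left b0 : port_num p1' = port_num (RecvL b0) -> port_num p2' = port_num (SendL b0) ->
  wstep ([seq i.2 | i <- A] ++ [:: x, y & [seq i.2 | i <- B]]) ([seq i.2 | i <- A] ++ [:: s1', s2' & [seq i.2 | i <- B]]).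
  move=> /(congr1 port_of); rewrite !port_numK => h1 /(congr1 port_of); rewrite !port_numK => h2.
  by subst; apply: wstep_left hd1 hd2.
case: i i6 hi e4 e8 {htr hen hm'} => [|[|[|[|[|[|i]]]]]] //= _ _ e4 e8.
- exact: (right None).
- exact: (right (Some false)).
- exact: (right (Some true)).
- exact: (left false).
- exact: (left true).
Qed.

Notation reachable := (reachable chain_sig chain_beh c).

Lemma nsteps_reachable n m0 W w' : unzip1 W = us -> encodes m0 W -> nsteps n (unzip2 W) w' ->
  exists m' W', [/\ reachable m0 m', encodes m' W', unzip1 W' = us & unzip2 W' = w'].
Proof.
have gen m W1 : reachable m0 m -> unzip1 W1 = us -> encodes m W1 -> nsteps n (unzip2 W1) w' ->
    exists m' W', [/\ reachable m0 m', encodes m' W', unzip1 W' = us & unzip2 W' = w'].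
  elim: n m W1 => [|n IH] m W1 hr eus hm /=; first by exists m, W1.
  case=> v /(net_step eus hm)[t [m' [W' [ht hf hm' eus' <-]]]].
  exact: IH (reach_step hr ht hf) eus' hm'.
by move=> eus hm; apply: gen => //; apply: reach_refl.
Qed.

(** Firings of spin transitions are dropped, so [n] may be smaller than the number of firings. *)
Lemma reachable_nsteps m0 m W : unzip1 W = us -> encodes m0 W -> reachable m0 m ->
  exists n W', [/\ nsteps n (unzip2 W) (unzip2 W'), encodes m W' & unzip1 W' = us].
Proof.
move=> eus hm0; elim=> [m1 h|m1 m2 t _ [n [W1 [h1 h2 h3]]] ht [hen hf]].
  by exists 0, W; split=> // q u; rewrite h; apply: hm0.
have [W' [e1 e2 [[_ eW]|st]]] := step_net h3 h2 ht hen hf.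
  by exists n, W1; rewrite -{2}eW.
exists (n + 1), W'; split=> //; apply: nsteps_cat h1 _; by exists (unzip2 W').
Qed.

(** An active cell other than [Halt] can spin; if the active cell is [Halt], nothing can spin and no
    message is sent. *)
Lemma dead_encodes W m : unzip1 W = us -> encodes m W -> single_active (unzip2 W) ->
  dead chain_sig chain_beh c m <-> Halt \in unzip2 W.
Proof.
move=> eus hm h1; split=> [hd|hH t ht hen].
  have : has (@active R Q) (unzip2 W) by rewrite has_count h1.
  case/hasP=> s hs ha; case: (eqVneq s Halt) => [<- //|ne].
  case/mapP: hs => -[u s'] hu /= es; subst s'.
  have hu1 : u \in us by rewrite -eus (map_f fst hu).
  case: (hd _ (spin_trans (spin_active ha ne) hu1)) => q w /pre1 /= [-> ->].
  by apply/hm; exists s.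
have [W' [e1 e2 [[[s hs hsp] _]|st]]] := step_net eus hm ht hen (fun _ _ => iff_refl _).
  have as_ : @active R Q s by case: (s) hsp.
  have es := active_mem_uniq h1 hH hs isT as_.
  by rewrite -es in hsp.
exact: halted_stuck h1 hH _ st.
Qed.

Section Reduction.
Hypothesis regs_lt : forall pc, pc < size Q -> ireg (nth (Inc 0) Q pc) < R.+1.
Variables (n : nat) (ls : seq (option 'I_R.+1)) (W : seq (nat * cell)).
Hypothesis ls_counts : counts (input n) ls.
Hypothesis W_us : unzip1 W = us.
Hypothesis W_marking : encodes (cmark c) W.
Hypothesis W_world : unzip2 W = world Q 0 ord0 ls.

Lemma net_sound m : reachable (cmark c) m ->
  dead chain_sig chain_beh c m \/ (exists u, m (code Halt) u) -> rm_halts Q n.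
Proof.
move=> /(reachable_nsteps W_us W_marking)[k [W' [hk hm eus]]] h.
rewrite W_world in hk; have h1 := nsteps_single hk (world_single Q 0 ord0 ls).
have hH : Halt \in unzip2 W'.
  case: h => [|[u /hm[s hs /code_inj ->]]]; first by move=> h; apply/(dead_encodes eus hm h1).
  exact: (map_f snd hs).
by have [j hj] := simulation_sound regs_lt ls_counts hk hH; exists j.
Qed.

Lemma net_complete k : k <= count_mem None ls ->
  size Q <= (iter k (rm_step Q) (0, input n)).1 ->
  exists m, [/\ reachable (cmark c) m, dead chain_sig chain_beh c m & exists u, m (code Halt) u].
Proof.
move=> hk hh; have [w [j hj] hH] := simulation_complete regs_lt ord0 ls_counts hk hh.
have h1 := nsteps_single hj (world_single Q 0 ord0 ls).
rewrite -W_world in hj.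
have [m [W' [hr hm eus e]]] := nsteps_reachable W_us W_marking hj.
exists m; split=> //; first by apply/(dead_encodes eus hm); rewrite e.
rewrite -e in hH; case/mapP: hH => -[u s] hu /= es; exists u; apply/hm.
by exists s; rewrite ?es.
Qed.

End Reduction.

(** For a nonempty program the initial controller is [Ctl ord0 ord0], which heads [cells] together
    with the other four states. *)
Lemma code_special : 0 < size Q ->
  [/\ code (Idle None ord0) = 0, code (Idle (Some ord0) ord0) = 1, code EndIdle = 2,
      code (control Q 0 ord0) = 3 & code Halt = 4].
Proof.
move=> h; have -> : control Q 0 ord0 = Ctl ord0 (ord0 : 'I_R.+1) :> cell.
  by rewrite /control h; congr (Ctl _ ord0); apply: val_inj; rewrite /= inordK.
by split.
Qed.

End Net.

(** * Configurations satisfying the chain formulas *)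

Definition lone (c : config) (u q : nat) : Prop :=
  [/\ forall v, ccomp c v <-> v = u, no_inter c &
      forall q' v, cmark c q' v <-> q' = q /\ v = u].

Definition only_inters (c : config) (P : pred nat) (t : seq nat) : Prop :=
  [/\ no_comp c, forall j t', cinter c j t' <-> P j /\ t' = t & no_mark c].

Section Denotation.
Variables (nst : nat) (D : SID).

(* Semantics relative to an interpretation I of the predicate symbols: [sat] is
   the least fixpoint, so inductions on [sat] reduce to closure of I under rules. *)
Fixpoint den (I : nat -> seq nat -> config -> Prop) (f : form) (s : store) (c : config) : Prop :=
  match f with
  | Emp => [/\ no_comp c, no_inter c & no_mark c]
  | Comp x => exists2 q, q < nst & lone c (s x) q
  | CompSt q x => q < nst /\ lone c (s x) q
  | Inter i xs => only_inters c (pred1 i) (map s xs)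
  | Pred a ys => I a (map s ys) c
  | Sep f g => exists c1 c2, [/\ den I f s c1, den I g s c2 & disj_union c c1 c2]
  | Ex x f => exists v, den I f (supd s x v) c
  end.

Lemma sat_den I s f c :
  (forall a xs body s c, List.In (a, xs, body) D -> den I body s c -> I a (map s xs) c) ->
  sat nst D s f c -> den I f s c.
Proof.
move=> hI; elim=> {s f c} /=.
- by move=> s c *; split.
- by move=> s x q c hq *; exists q.
- by move=> s x q c hq *; split.
- move=> s i xs c h1 h2 h3; split=> // j t; rewrite h2; split=> -[]; first by move=> -> ->; rewrite /= eqxx.
  by move=> /eqP -> ->.
- move=> s a ys xs body s' c hin sz hs _ /(hI _ _ _ _ _ hin).
  suff -> : map s' xs = map s ys by [].
  apply: (@eq_from_nth _ 0); rewrite ?size_map // => j hj.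
  by rewrite !(nth_map 0) -?sz // hs.
- by move=> s f g c c1 c2 _ h1 _ h2 h; exists c1, c2.
- by move=> s x v f c _ h; exists v.
Qed.

Lemma den_sat I s f c :
  (forall a ys s c, I a (map s ys) c -> sat nst D s (Pred a ys) c) ->
  den I f s c -> sat nst D s f c.
Proof.
move=> hI; elim: f s c => /=.
- by move=> s c [*]; apply: sat_emp.
- by move=> x s c [q hq [*]]; apply: (@sat_comp _ _ _ _ q).
- by move=> q x s c [hq [*]]; apply: (@sat_compst _ _ _ _ q).
- move=> i xs s c [h1 h2 h3]; apply: sat_inter => // j t; rewrite h2 /=.
  by split=> -[] => [/eqP -> ->|-> ->].
- by move=> a ys s c; apply: hI.
- by move=> f IHf g IHg s c [c1 [c2 [/IHf h1 /IHg h2 h]]]; apply: sat_sep h1 h2 h.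
- by move=> x f IH s c [v /IH h]; apply: sat_ex h.
Qed.

Lemma den_sep I f g s c : den I (Sep f g) s c <->
  exists c1 c2, [/\ den I f s c1, den I g s c2 & disj_union c c1 c2].
Proof. by []. Qed.

Lemma den_ex I x f s c : den I (Ex x f) s c <-> exists v, den I f (supd s x v) c.
Proof. by []. Qed.

Lemma den_seps_inters I s xs js c : uniq js ->
  den I (seps [seq Inter i xs | i <- js]) s c <-> only_inters c (mem js) (map s xs).
Proof.
elim: js c => [|j js IH] c /=.
  by move=> _; split=> -[h1 h2 h3]; split=> // i t; [split=> [/h2|[]]|move=> /h2[]].
move=> /andP[hj hu]; split.
  move=> [c1 [c2 [[n1 e1 m1] /(proj1 (IH _ hu)) [n2 e2 m2] [u1 [_ [u3 [_ u5]]]]]]].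
  split.
  - by move=> u /u1 [/n1|/n2].
  - move=> i t; rewrite u3 e1 e2 /= inE; split=> [[[/eqP -> ->]|[h ->]]|[/orP[/eqP ->|h] ->]].
    + by rewrite eqxx.
    + by split=> //; apply/orP; right.
    + by left; rewrite eqxx.
    + by right.
  - by move=> q u /u5 [/m1|/m2].
move=> [n e m].
exists (Config (fun _ => False) (fun i t => i = j /\ t = map s xs) (fun _ _ => False)).
exists (Config (fun _ => False) (fun i t => i \in js /\ t = map s xs) (fun _ _ => False)).
split; first 1 last.
- by apply: (proj2 (IH _ hu)); split=> [u []|i t|q u []]; split.
- split; last split; last split; last split; rewrite /=.
  + by move=> u; split=> [/n|[]].
  + by move=> u [].
  + move=> i t; rewrite e /= inE; split=> [[/orP[/eqP ->|h] ->]|[[-> ->]|[h ->]]]; auto.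
      by rewrite eqxx.
    by rewrite h orbT.
  + by move=> i t [[-> _] [h _]]; rewrite h in hj.
  + by move=> q u; split=> [/m|[]].
by split=> [u []|i t|q u []] /=; split=> -[] => [->|/eqP ->].
Qed.

Definition unary (x : nat) : form :=
  seps [seq Inter i [:: x] | i <- inters_of_arity chain_sig 1].
Definition binary (x z : nat) : form :=
  seps [seq Inter i [:: x; z] | i <- inters_of_arity chain_sig 2].
(** The body of the recursive rule of [Lambda] with an arbitrary head and tail; building all
    formulas from it makes them linear. *)
Definition block (hd : form) (x z : nat) (g : form) : form :=
  Ex z (Sep hd (Sep (unary x) (Sep (binary x z) g))).

Lemma den_unary I s x c : den I (unary x) s c <-> only_inters c (pred1 0) [:: s x].
Proof.
rewrite den_seps_inters //; split=> -[h1 h2 h3]; split=> // j t; rewrite h2 /=;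
  by rewrite inE.
Qed.

Lemma den_binary I s x z c :
  den I (binary x z) s c <-> only_inters c (fun i => 0 < i < 6) [:: s x; s z].
Proof.
by rewrite den_seps_inters //; split=> -[h1 h2 h3]; split=> // j t; rewrite h2 /=;
  rewrite !inE; do 6?[case: j => [//|j]].
Qed.

(** * Chains as models of blocks *)

Definition is_chain (W : seq (nat * nat)) (c : config) : Prop :=
  [/\ uniq (unzip1 W), forall u, ccomp c u <-> u \in unzip1 W,
      forall i t, cinter c i t <-> linked (unzip1 W) i t,
      forall q u, cmark c q u <-> (u, q) \in W & all (gtn nst) (unzip2 W)].

Definition chain_config (W : seq (nat * nat)) : config :=
  Config (fun u => u \in unzip1 W) (linked (unzip1 W)) (fun q u => (u, q) \in W).

Lemma chain_config_is_chain W :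
  uniq (unzip1 W) -> all (gtn nst) (unzip2 W) -> is_chain W (chain_config W).
Proof. by split. Qed.

Lemma linked_mem us i t : linked us i t -> nth 0 t 0 \in us.
Proof.
by case/linkedP=> [[a [u [b [_ -> ->]]]]|[a [u [v [b [_ -> ->]]]]]];
  rewrite mem_cat inE eqxx orbT.
Qed.

Lemma linked_cons u v us i t : ohead us = Some v ->
  linked (u :: us) i t =
  [|| (i == 0) && (t == [:: u]), (0 < i < 6) && (t == [:: u; v]) | linked us i t].
Proof. by case: us => //= y us [->]. Qed.

(** Treats [Comp] and [CompSt] alike; [P] is the set of states that the head allows. *)
Definition cell_form (hd : form) (x : nat) (P : pred nat) :=
  forall I s c, den I hd s c <-> exists q, [/\ q < nst, P q & lone c (s x) q].

Lemma cell_form_comp x : cell_form (Comp x) x predT.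
Proof. by move=> I s c; split=> [[q]|[q []]] *; exists q. Qed.

Lemma cell_form_compst q x : cell_form (CompSt q x) x (pred1 q).
Proof.
move=> I s c; split=> [[h1 h2]|[q' [h /eqP e h']]]; last by subst q'.
by exists q; split=> //=.
Qed.

Lemma den_last I hd x P s c : cell_form hd x P ->
  den I (Sep hd (unary x)) s c <-> exists2 q, is_chain [:: (s x, q)] c & P q.
Proof.
move=> hhd; split.
  move=> /den_sep [c1 [c2 [/hhd [q [hq hP [a1 a2 a3]]] /(den_unary I) [b1 b2 b3]]]].
  move=> [u1 [_ [u3 [_ u5]]]].
  exists q => //; split=> //=.
  - move=> u; rewrite u1 a1 /= inE; split=> [[->//|/b1 //]|/eqP]; auto.
  - move=> i t; rewrite u3 b2 /= !orbF; split=> [[/a2 //|[-> ->]]|/andP[h /eqP ->]]; auto.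
    by rewrite eqxx.
  - move=> q' u; rewrite u5 a3 inE; split=> [[[-> ->]//|/b3 //]|/eqP[-> ->]]; auto.
  - by rewrite hq.
move=> [q [h1 h2 h3 h4 /andP[hq _]] hP].
apply/den_sep; exists (Config (fun v => v = s x) (fun _ _ => False) (fun q' v => q' = q /\ v = s x)).
exists (Config (fun v => False) (fun i t => i = 0 /\ t = [:: s x]) (fun q' v => False)).
split; first by apply/hhd; exists q; split=> //; split=> [v|i t []|q2 v]; split.
  by apply/(den_unary I); split=> [u []|i t|q2 u []] /=; split=> -[] => [->|/eqP ->].
split; last split; last split; last split; rewrite /=.
- by move=> u; rewrite h2 /= inE; split=> [/eqP ->|[->|[]]]; rewrite ?eqxx; auto.
- by move=> u [].
- move=> i t; rewrite h3 /= !orbF; split=> [/andP[/eqP -> /eqP ->]|[[]|[-> ->]]]; auto.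
  by rewrite !eqxx.
- by move=> i t [].
- by move=> q' u; rewrite h4 inE; split=> [/eqP[-> ->]|[[-> ->]|[]]]; rewrite ?eqxx; auto.
Qed.

(** A block prepends one component to a chain that starts at the value of [z]; separation makes this
    component new. [T] carries what is known about the states of the tail. *)
Lemma den_block_chain I hd x z g P (T : seq nat -> Prop) s c : x != z -> cell_form hd x P ->
  (forall s c, den I g s c ->
     exists W, [/\ is_chain W c, ohead (unzip1 W) = Some (s z) & T (unzip2 W)]) ->
  den I (block hd x z g) s c ->
  exists q W, [/\ is_chain ((s x, q) :: W) c, P q & T (unzip2 W)].
Proof.
move=> xz hhd hg /den_ex [v /den_sep [c1 [c234 [/hhd [q [hq hP [a1 a2 a3]]]]]]].
move=> /den_sep [c2 [c34 [/(den_unary I) [b1 b2 b3]]]].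
move=> /den_sep [c3 [c4 [/(den_binary I) [k1 k2 k3] /hg h4 w3]]] w2 w1.
have sx : supd s z v x = s x by rewrite /supd (negPf xz).
have sz : supd s z v z = v by rewrite /supd eqxx.
rewrite {}sx {}sz in a1 a3 b2 k2 h4.
case: h4 => W [[f1 f2 f3 f4 f5] ev hT].
case: w1 => [u1 [x1 [u3 [_ u5]]]]; case: w2 => [v1 [_ [v3 [_ v5]]]]; case: w3 => [y1 [_ [y3 [_ y5]]]].
have hv : v \in unzip1 W by case: (unzip1 W) ev => //= y us [->]; rewrite inE eqxx.
exists q, W; split=> //; split; rewrite -?[unzip1 _]/(s x :: unzip1 W).
- rewrite cons_uniq f1 andbT; apply/negP => h; apply: (x1 (s x)); split; first by apply/a1.
  by apply/v1; right; apply/y1; right; apply/f2.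
- move=> u; rewrite u1 v1 y1 a1 f2 in_cons.
  by split=> [[->|[/b1 //|[/k1 //|->]]]|/orP[/eqP|]]; rewrite ?eqxx ?orbT //; auto.
- move=> i t; rewrite u3 v3 y3 b2 k2 f3 (linked_cons _ _ _ ev); split.
    by move=> [/a2 //|[[/eqP -> ->]|[[-> ->]|->]]]; rewrite ?eqxx ?orbT.
  by move=> /or3P[/andP[h /eqP ->]|/andP[h /eqP ->]|]; auto.
- move=> q2 u; rewrite u5 v5 y5 a3 f4 in_cons.
  by split=> [[[-> ->]|[/b3 //|[/k3 //|->]]]|/orP[/eqP[-> ->]|]]; rewrite ?eqxx ?orbT //; auto.
- by rewrite /= hq.
Qed.

Lemma chain_den_block I hd x z g P s c u q W : x != z -> cell_form hd x P ->
  is_chain ((u, q) :: W) c -> P q -> s x = u -> 0 < size W ->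
  (forall v c', ohead (unzip1 W) = Some v -> is_chain W c' -> den I g (supd s z v) c') ->
  den I (block hd x z g) s c.
Proof.
move=> xz hhd; move=> [h1 h2 h3 h4 /andP[hq h5]] hP sx hsz hg.
have [v ev] : exists v, ohead (unzip1 W) = Some v.
  by case: (W) hsz => [//|p W'] _; exists p.1.
have {h1} [hu hW] : u \notin unzip1 W /\ uniq (unzip1 W) by apply/andP.
apply/den_ex; exists v; have sx' : supd s z v x = u by rewrite /supd (negPf xz).
have sz' : supd s z v z = v by rewrite /supd eqxx.
set s' := supd s z v in sx' sz' *.
(* [C2] holds the unary interaction of [u], [C3] the binary ones from [u] to [v], and [C4] the rest
   of the chain. *)
pose C4 := chain_config W.
pose C3 := Config (fun _ => False) (fun i t => (0 < i < 6) /\ t = [:: u; v]) (fun _ _ => False).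
pose C2 := Config (fun _ => False) (fun i t => i == 0 /\ t = [:: u]) (fun _ _ => False).
pose C34 := Config (fun w => w \in unzip1 W) (fun i t => cinter C3 i t \/ cinter C4 i t) (fun q u => (u, q) \in W).
pose C234 := Config (fun w => w \in unzip1 W) (fun i t => cinter C2 i t \/ cinter C34 i t) (fun q u => (u, q) \in W).
apply/den_sep; exists (Config (fun v => v = u) (fun _ _ => False) (fun q' v => q' = q /\ v = u)), C234; split.
- by apply/hhd; exists q; split=> //; rewrite sx'; split=> [w|i t []|q2 w]; split.
- apply/den_sep; exists C2, C34; split.
  + by apply/(den_unary I); rewrite sx'; split=> [w []|i t|q2 w []]; split.
  + apply/den_sep; exists C3, C4; split.
    * by apply/(den_binary I); rewrite sx' sz'; split=> [w []|i t|q2 w []]; split.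
    * by apply: hg => //; apply: chain_config_is_chain.
    split; last split; last split; last split; rewrite //=.
    - by move=> w /=; split=> [|[]]; auto.
    - by move=> w [].
    (* An interaction of the tail starts at a component of the tail, hence not at [u]. *)
    - move=> i t [[_ ->] /linked_mem /=]; exact/negP.
    - by move=> q2 w; split=> [|[]]; auto.
  split; last split; last split; last split; rewrite //=.
  - by move=> w /=; split=> [|[]]; auto.
  - by move=> w [].
  - move=> i t [[/eqP -> ->] [[] //|/linked_mem /=]]; exact/negP.
  - by move=> q2 w; split=> [|[]]; auto.
split; last split; last split; last split; rewrite /=.
- by move=> w; rewrite h2 -[unzip1 _]/(u :: unzip1 W) in_cons; split=> [/orP[/eqP|]|[->|->]]; rewrite ?eqxx ?orbT; auto.
- by move=> w [-> h]; rewrite h in hu.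
- move=> i t; rewrite h3 -[unzip1 _]/(u :: unzip1 W) (linked_cons _ _ _ ev); split.
    by move=> /or3P[/andP[h /eqP ->]|/andP[h /eqP ->]|]; auto.
  by move=> [[]|[[-> ->]|[[-> ->]|->]]]; rewrite ?eqxx ?orbT.
- by move=> i t [].
- by move=> q2 w; rewrite h4 in_cons; split=> [/orP[/eqP[-> ->]|]|[[-> ->]|->]]; rewrite ?eqxx ?orbT; auto.
Qed.

End Denotation.

(** * The reduction *)

Definition free_body : form := block (CompSt 0 0) 0 1 (Pred 0 [:: 1]).
Definition last_body : form := Sep (CompSt 2 0) (unary 0).
(** Predicate 0 produces any number of free cells closed by the end cell; the length of the chain is
    chosen here. *)
Definition tail_SID : SID := [:: (0, [:: 0], free_body); (0, [:: 0], last_body)].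

(* Each unit of input also contributes a free cell, so that every step of the
   iteration returns to the variable 0. *)
Definition input_block (g : form) : form :=
  block (CompSt 0 0) 0 1 (block (CompSt 1 1) 1 0 g).
Definition input_form (n : nat) : form := iter n input_block (Pred 0 [:: 0]).
(** The free cell after the controller brings the current variable back to 0, where [input_form]
    expects it. *)
Definition chain_form (n : nat) : form :=
  Ex 0 (block (CompSt 3 0) 0 1 (block (CompSt 0 1) 1 0 (input_form n))).

Definition input_states (n k : nat) : seq nat :=
  iter n (fun qs => [:: 0, 1 & qs]) (nseq k 0 ++ [:: 2]).
Definition chain_states (n k : nat) : seq nat := [:: 3, 0 & input_states n k].

Section Models.
Variables (nst : nat) (E : SID).
Hypothesis E_pos : forall r, List.In r E -> r.1.1 <> 0.
Let D := tail_SID ++ E.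

(** Only predicate 0 is constrained, so closure under the rules of [E] is immediate; [E] is empty
    for the decision problems and [Lambda] for linearity. *)
Definition tail_model (a : nat) (vs : seq nat) (c : config) : Prop :=
  a = 0 -> exists W, [/\ is_chain nst W c, ohead (unzip1 W) = ohead vs &
    exists k, unzip2 W = nseq k 0 ++ [:: 2]].

Lemma tail_model_closed a xs body s c : List.In (a, xs, body) D ->
  den nst tail_model body s c -> tail_model a (map s xs) c.
Proof.
move=> [[<- <- <-]|[[<- <- <-]|/E_pos ne]] + a0; last by case: ne.
  move/(@den_block_chain nst _ _ 0 1 _ _ (fun qs => exists k, qs = nseq k 0 ++ [:: 2])
    _ _ isT (@cell_form_compst nst 0 0)).
  case=> [s' c' /(_ erefl) [W [h1 h2 h3]]|q [W [h1 /eqP eq [k hk]]]]; first by exists W.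
  by exists ((s 0, q) :: W); split=> //; exists k.+1; rewrite /= hk eq.
move/(den_last _ _ _ (@cell_form_compst nst 2 0)) => [q h /eqP eq].
by exists [:: (s 0, q)]; split=> //; exists 0; rewrite /= eq.
Qed.

Lemma input_form_model n s c : den nst tail_model (input_form n) s c ->
  exists W, [/\ is_chain nst W c, ohead (unzip1 W) = Some (s 0) &
    exists k, unzip2 W = input_states n k].
Proof.
elim: n s c => [|n IH] s c; first by move/(_ erefl).
move/(@den_block_chain nst _ _ 0 1 _ _ (fun qs => exists k, qs = 1 :: input_states n k)
    _ _ isT (@cell_form_compst nst 0 0)).
case=> [s' c'|q [W [h1 /eqP eq [k hk]]]]; last first.
  by exists ((s 0, q) :: W); split=> //; exists k; rewrite /= hk eq.
move/(@den_block_chain nst _ _ 1 0 _ _ (fun qs => exists k, qs = input_states n k)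
    _ _ isT (@cell_form_compst nst 1 1)).
case=> [//|q [W [h1 /eqP eq [k hk]]]].
by exists ((s' 1, q) :: W); split=> //; exists k; rewrite /= hk eq.
Qed.

Lemma chain_form_model n s c : sat nst D s (chain_form n) c ->
  exists W k, is_chain nst W c /\ unzip2 W = chain_states n k.
Proof.
move/(sat_den tail_model_closed)/den_ex => [v].
move/(@den_block_chain nst _ _ 0 1 _ _ (fun qs => exists k, qs = 0 :: input_states n k)
    _ _ isT (@cell_form_compst nst 3 0)).
case=> [s' c'|q [W [h1 /eqP eq [k hk]]]]; last first.
  by exists ((supd s 0 v 0, q) :: W), k; split=> //; rewrite /= hk eq.
move/(@den_block_chain nst _ _ 1 0 _ _ (fun qs => exists k, qs = input_states n k)
    _ _ isT (@cell_form_compst nst 0 1)).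
case=> [s2 c2 /input_form_model //|q [W [h1 /eqP eq [k hk]]]].
by exists ((s' 1, q) :: W); split=> //; exists k; rewrite /= hk eq.
Qed.

Definition sat_pred_model (a : nat) (vs : seq nat) (c : config) : Prop :=
  forall s ys, map s ys = vs -> sat nst D s (Pred a ys) c.

Lemma sat_of_den s f c : den nst sat_pred_model f s c -> sat nst D s f c.
Proof. by apply: den_sat => a ys s' c' h; apply: h. Qed.

Lemma tail_sat k W c s y : unzip2 W = nseq k 0 ++ [:: 2] -> is_chain nst W c ->
  ohead (unzip1 W) = Some (s y) -> sat nst D s (Pred 0 [:: y]) c.
Proof.
elim: k W c s y => [|k IH] [//|[u q] W] c s y [eq eW] hW [eu]; subst.
  case: W eW hW => // _ hW.
  apply: (@sat_pred _ _ s 0 [:: y] [:: 0] last_body (fun=> s y)) => //.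
  - by right; left.
  - by case.
  apply: sat_of_den; apply/(den_last _ _ _ (@cell_form_compst nst 2 0)).
  by exists 2.
apply: (@sat_pred _ _ s 0 [:: y] [:: 0] free_body (fun=> s y)) => //.
- by left.
- by case.
apply: sat_of_den; apply: (@chain_den_block nst _ _ 0 1 _ _ _ _ _ _ _ isT (@cell_form_compst nst 0 0) hW) => //.
  by case: (W) eW => //; case: (k).
move=> v c' hv hc' s' ys; case: ys => [//|y' [|//]] [e].
by apply: IH eW hc' _; rewrite hv e.
Qed.

Lemma input_form_den n k W c s : unzip2 W = input_states n k -> is_chain nst W c ->
  ohead (unzip1 W) = Some (s 0) -> den nst sat_pred_model (input_form n) s c.
Proof.
elim: n W c s => [|n IH] W c s eW hW hv.
  move=> s' ys; case: ys => [//|y' [|//]] [e].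
  by apply: tail_sat eW hW _; rewrite hv e.
case: W eW hW hv => [//|[u q] W] [-> eW] hW [eu]; subst.
apply: (@chain_den_block nst _ _ 0 1 _ _ _ _ _ _ _ isT (@cell_form_compst nst 0 0) hW) => //.
  by case: (W) eW.
case: W eW {hW} => [//|[u' q'] W] [-> eW] v c' [<-] hW.
apply: (@chain_den_block nst _ _ 1 0 _ _ _ _ _ _ _ isT (@cell_form_compst nst 1 1) hW) => //.
  by case: (W) eW => //; case: (n) => //; case: (k).
by move=> v' c2 hv hc2; apply: IH eW hc2 _; rewrite hv.
Qed.

Lemma chain_form_sat n k W c s : unzip2 W = chain_states n k -> is_chain nst W c ->
  sat nst D s (chain_form n) c.
Proof.
case: W => [//|[u q] W] [-> eW] hW.
apply: sat_of_den; apply/den_ex; exists u.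
apply: (@chain_den_block nst _ _ 0 1 _ _ _ _ _ _ _ isT (@cell_form_compst nst 3 0) hW) => //.
  by case: (W) eW.
case: W eW {hW} => [//|[u' q'] W] [-> eW] v c' [<-] hW.
apply: (@chain_den_block nst _ _ 1 0 _ _ _ _ _ _ _ isT (@cell_form_compst nst 0 1) hW) => //.
  by case: (W) eW => //; case: (n) => //; case: (k).
by move=> v' c2 hv hc2; apply: input_form_den eW hc2 _; rewrite hv.
Qed.

End Models.

(** * Linearity and well-formedness of the instances *)

Lemma Lambda_sat nst D L W c s y1 y2 : is_chain nst W c ->
  (forall r, List.In r (Lambda chain_sig L) -> List.In r D) ->
  ohead (unzip1 W) = Some (s y1) -> last 0 (unzip1 W) = s y2 ->
  sat nst D s (Pred L [:: y1; y2]) c.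
Proof.
move=> + hD; elim: W c s y1 y2 => [//|[u q] W IH] c s y1 y2 hW [eu] hl; subst.
case: W IH hW hl => [_|p W IH] hW hl.
  (* In a chain of one cell the first and last components coincide, as the repeated parameter
     demands. *)
  apply: (@sat_pred _ _ s L [:: y1; y2] [:: 0; 0] (Sep (Comp 0) (unary 0)) (fun=> s y1)) => //.
  - by apply: hD; left.
  - by case=> [|[|j]].
  apply: (@den_sat _ _ (fun a vs c => forall s ys, map s ys = vs -> sat nst D s (Pred a ys) c)).
    by move=> a ys s' c' h; apply: h.
  by apply/(den_last _ _ _ (@cell_form_comp nst 0)); exists q.
apply: (@sat_pred _ _ s L [:: y1; y2] [:: 0; 1] (block (Comp 0) 0 2 (Pred L [:: 2; 1]))
  (fun j => if j == 0 then s y1 else s y2)) => //.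
- by apply: hD; right; left.
- by case=> [|[|j]].
apply: (@den_sat _ _ (fun a vs c => forall s ys, map s ys = vs -> sat nst D s (Pred a ys) c)).
  by move=> a ys s' c' h; apply: h.
apply: (@chain_den_block nst _ _ 0 2 _ _ _ _ _ _ _ isT (@cell_form_comp nst 0) hW) => //.
move=> v c' hv hc' s' ys; case: ys => [//|z1 [//|z2 [|//]]] [e1 e2].
by apply: IH => //; rewrite ?e1 ?e2.
Qed.

Lemma chain_form_linear nst n : linear chain_sig nst tail_SID (chain_form n).
Proof.
rewrite /linear; set L := freshL _ _ => c.
have hL : forall r, List.In r (Lambda chain_sig L) -> r.1.1 <> 0.
  (* [freshL] is a successor, so it differs from predicate 0. *)
  by move=> r [<-|[<-|[]]].
move/(chain_form_model hL) => [[|[u q] W] [k [hW //]] _].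
apply: (@sat_ex _ _ _ _ u); apply: (@sat_ex _ _ _ _ (last 0 (unzip1 ((u, q) :: W)))).
by apply: Lambda_sat hW _ _ _ => // r hr; right; right.
Qed.

Lemma fv_block hd x z g : x != z -> fv hd = [:: x] -> all (pred1 z) (fv g) ->
  all (pred1 x) (fv (block hd x z g)).
Proof.
move=> xz ehd /allP hg; apply/allP => y.
have -> : fv (block hd x z g) =
  [seq y <- fv hd ++ fv (unary x) ++ fv (binary x z) ++ fv g | y != z] by [].
rewrite mem_filter !mem_cat ehd => /andP[yz].
case/or4P=> [||h|/hg /= /eqP e]; last by rewrite e eqxx in yz.
- by rewrite inE.
- by rewrite !inE orbF.
by move: h; rewrite !inE (negPf yz) !(orbF, orbb).
Qed.

Lemma chain_form_sentence n : sentence (chain_form n).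
Proof.
have h : all (pred1 0) (fv (input_form n)).
  by elim: n => // n IH; apply: fv_block => //; apply: fv_block.
have /allP h' : all (pred1 0) (fv (block (CompSt 3 0) 0 1 (block (CompSt 0 1) 1 0 (input_form n)))).
  by apply: fv_block => //; apply: fv_block.
apply/eqP; rewrite -size_eq0 -leqn0 leqNgt -has_predT; apply/hasPn => y.
by rewrite mem_filter => /andP[h1 /h' /= h2]; rewrite h2 in h1.
Qed.

Lemma wf_block nst D hd x z g : wf_form chain_sig nst D hd -> wf_form chain_sig nst D g ->
  wf_form chain_sig nst D (block hd x z g).
Proof. by move=> h1 h2; do !split. Qed.

Lemma tail_wf nst : 4 < nst -> wf_SID chain_sig nst tail_SID.
Proof.
move=> h r [<-|[<-|[]]]; split.
- apply: wf_block; first by rewrite /=; lia.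
  by move=> r' [<-|[<-|[]]].
- have -> : fv (0, [:: 0], free_body).2 = nseq 7 0 by [].
  by move=> z; rewrite mem_nseq inE.
- by move=> r' [<-|[<-|[]]].
- by do !split=> //=; lia.
- have -> : fv (0, [:: 0], last_body).2 = nseq 2 0 by [].
  by move=> z; rewrite mem_nseq inE.
- by move=> r' [<-|[<-|[]]].
Qed.

Lemma chain_form_wf nst n : 4 < nst -> wf_form chain_sig nst tail_SID (chain_form n).
Proof.
move=> h.
have hi : wf_form chain_sig nst tail_SID (input_form n).
  elim: n => [|n IH]; first by move=> r' [<-|[<-|[]]].
  by apply: wf_block; [|apply: wf_block => //]; rewrite /=; lia.
suff: wf_form chain_sig nst tail_SID
  (block (CompSt 3 0) 0 1 (block (CompSt 0 1) 1 0 (input_form n))) by [].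
by apply: wf_block; [|apply: wf_block => //]; rewrite /=; lia.
Qed.

(* The codes are towers of powers of 2 and must not be evaluated. *)
#[local] Opaque cpair.

(** The tail of a block is the innermost second component of its code; 5 and 6 are the tags of [Sep]
    and [Ex]. *)
Definition block_codes (hd : form) (x z : nat) : seq nat :=
  [:: enc_form (binary x z); 5; enc_form (unary x); 5; enc_form hd; 5; z; 6].

Lemma enc_block hd x z g :
  enc_form (block hd x z g) = cpairs (block_codes hd x z) (enc_form g).
Proof. by []. Qed.

Definition input_codes : seq nat :=
  block_codes (CompSt 1 1) 1 0 ++ block_codes (CompSt 0 0) 0 1.
Definition head_codes : seq nat :=
  block_codes (CompSt 0 1) 1 0 ++ block_codes (CompSt 3 0) 0 1 ++ [:: 0; 6].

Lemma cpairs_app es es' x : cpairs (es ++ es') x = cpairs es' (cpairs es x).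
Proof. exact: foldl_cat. Qed.

Lemma enc_input_form n :
  enc_form (input_form n) = iter n (cpairs input_codes) (enc_form (Pred 0 [:: 0])).
Proof.
elim: n => [|n IH]; first by [].
rewrite iterS -IH /input_codes cpairs_app -!enc_block; reflexivity.
Qed.

Lemma enc_chain_form n :
  enc_form (chain_form n) = cpairs head_codes (iter n (cpairs input_codes) (enc_form (Pred 0 [:: 0]))).
Proof. by rewrite -enc_input_form /head_codes !cpairs_app -!enc_block. Qed.

(** The self-reference of the diagonal argument: the formula stores the code of the behaviour that
    runs on it. *)
Definition instance_of (B : behavior) : dl_instance := (tail_SID, B, chain_form (enc_beh B)).

Lemma enc_instance B : enc_dl (instance_of B) =
  instance_code input_codes head_codes (enc_form (Pred 0 [:: 0])) (enc_SID tail_SID) (enc_beh B).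
Proof. by rewrite /instance_code -enc_chain_form. Qed.

(** * The instance obtained from a machine *)

Section Instance.
Variable Q : seq instr.
Hypothesis Q_pos : 0 < size Q.
Let R := \max_(i <- [seq ireg i | i <- Q]) i.
Let B := chain_beh R Q.
Let n := enc_beh B.
Notation cell := (cell R (size Q)).
Notation code := (@code R Q).

Lemma ireg_lt pc : pc < size Q -> ireg (nth (Inc 0) Q pc) < R.+1.
Proof.
move=> h; rewrite ltnS -(nth_map _ 0) //.
by apply: (@leq_bigmax_seq _ _ predT id) => //; rewrite mem_nth ?size_map.
Qed.

(** The contents of the cells behind the controller in [chain_states n k]. *)
Definition labels (k : nat) : seq (option 'I_R.+1) :=
  None :: iter n (fun l => [:: None, Some ord0 & l]) (nseq k None).

Lemma labels_counts k : counts (input n) (labels k).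
Proof.
move=> r; rewrite /labels /= add0n /input /rupd.
have -> m : count_mem (Some r) (iter m (fun l => [:: None, Some ord0 & l]) (nseq k None))
   = if r == 0 :> nat then m else 0.
  elim: m => [|m /= ->]; first by rewrite count_nseq; case: ifP.
  rewrite add0n; case: (eqVneq (r : nat) 0) => [e|ne].
    by rewrite (_ : _ == _ = true) //; apply/eqP; congr Some; apply: val_inj.
  by case: eqP => // -[e]; rewrite -e in ne.
by [].
Qed.

Lemma labels_free k : k <= count_mem None (labels k).
Proof.
rewrite /labels /=; elim: n => [|m IH] /=; first by rewrite count_nseq /=; lia.
by lia.
Qed.

Lemma code_world k : map code (world Q 0 ord0 (labels k)) = chain_states n k.
Proof.
have [c0 c1 c2 c3 _] := code_special R Q_pos.
rewrite /world /labels /chain_states /= c3 c0; congr [:: _, _ & _].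
elim: n => [|m IH] /=; last by rewrite c0 c1 IH.
by elim: k => [|k IH] /=; rewrite ?c2 ?c0 ?IH.
Qed.

Lemma nst_gt4 : 4 < beh_nst B.
Proof. by have [_ _ _ _ <-] := code_special R Q_pos; apply: code_lt. Qed.

Lemma instance_valid : valid_dl chain_sig (instance_of B).
Proof.
split; [exact: tail_wf nst_gt4|exact: chain_beh_wf|exact: chain_form_wf nst_gt4
  |exact: chain_form_sentence|exact: chain_form_linear].
Qed.

Lemma decode_chain W k : unzip2 W = chain_states n k ->
  exists W' : seq (nat * cell), [/\ W = [seq (p.1, code p.2) | p <- W'],
    unzip1 W' = unzip1 W & unzip2 W' = world Q 0 ord0 (labels k)].
Proof.
rewrite -code_world; elim: W (world _ _ _ _) => [|[u q] W IH] [|s w] //=.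
  by exists [::].
by case=> -> /IH[W' [-> <- <-]]; exists ((u, s) :: W').
Qed.

Lemma chain_encodes W c (W' : seq (nat * cell)) : is_chain (beh_nst B) W c ->
  W = [seq (p.1, code p.2) | p <- W'] -> encodes (cmark c) W'.
Proof.
move=> [_ _ _ h _] eW q u; rewrite h eW; split=> [/mapP[[v s] hs [-> ->]]|[s hs ->]].
  by exists s.
by apply/mapP; exists (u, s).
Qed.

Lemma chain_precise W c : is_chain (beh_nst B) W c -> precise (beh_nst B) c.
Proof.
move=> [h1 h2 h3 h4 h5]; split=> [u|q u].
  move=> /h2 /mapP[[v q] hq /= ->]; exists q; split.
  - by have /allP := h5; apply; apply: (map_f snd hq).
  - exact/h4.
  by move=> q' /h4 hq'; apply: unzip1_uniq_inj h1 hq' hq.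
move=> /h4 hq; split; first by apply/h2; exact: (map_f fst hq).
by have /allP := h5; apply; apply: (map_f snd hq).
Qed.

Lemma model_sound c m : sat (beh_nst B) tail_SID store0 (chain_form n) c ->
  reachable chain_sig B c (cmark c) m ->
  dead chain_sig B c m \/ (exists u, m 4 u) -> rm_halts Q n.
Proof.
rewrite -[tail_SID]cats0 => /chain_form_model [] // W [k [hW eW]].
have [W' [e1 e2 e3]] := decode_chain eW.
have hm := chain_encodes hW e1.
have [_ _ _ _ c4] := code_special R Q_pos; rewrite -[4]c4.
by case: hW => hu _ hi _ _; apply: (net_sound hu hi ireg_lt (labels_counts k) e2 hm e3).
Qed.

Lemma model_complete : rm_halts Q n -> exists c m,
  [/\ sat (beh_nst B) tail_SID store0 (chain_form n) c, precise (beh_nst B) c,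
      reachable chain_sig B c (cmark c) m, dead chain_sig B c m & exists u, m 4 u].
Proof.
(* The tail gets as many free cells as the halting run has steps. *)
move=> [k hk]; pose w := world Q 0 ord0 (labels k).
pose W := zip (iota 0 (size w)) (map code w).
have eW : unzip2 W = chain_states n k by rewrite unzip2_zip ?size_map ?size_iota // code_world.
have e1W : unzip1 W = iota 0 (size w) by rewrite unzip1_zip ?size_map ?size_iota.
have hW : is_chain (beh_nst B) W (chain_config W).
  apply: chain_config_is_chain; first by rewrite e1W iota_uniq.
  rewrite eW -code_world; apply/allP => q /mapP[s _ ->]; exact: code_lt.
have [W' [e1 e2 e3]] := decode_chain eW.
have hm := chain_encodes hW e1.
have hu : uniq (unzip1 W) by rewrite e1W iota_uniq.
have [|m [h1 h2 h3]] := net_complete hu _ ireg_lt (labels_counts k) e2 hm e3 (labels_free k) hk.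
  by [].
have [_ _ _ _ c4] := code_special R Q_pos; rewrite c4 in h3.
exists (chain_config W), m; split=> //; last exact: chain_precise hW.
rewrite -[tail_SID]cats0; exact: chain_form_sat eW hW.
Qed.

Lemma instance_deadlock : LinearDeadlock chain_sig (instance_of B) <-> rm_halts Q n.
Proof.
split=> [[c [h1 _ [m h2 h3]]]|/model_complete[c [m [h1 h2 h3 h4 _]]]].
  by apply: model_sound h1 h2 _; left.
by exists c; split=> //; exists m.
Qed.

(** State 4 is the code of [Halt]. *)
Lemma instance_reach : LinearReachability chain_sig (instance_of B, 4) <-> rm_halts Q n.
Proof.
split=> [[c [h1 _ [m h2 h3]]]|/model_complete[c [m [h1 h2 h3 _ h4]]]].
  by apply: model_sound h1 h2 _; right.
by exists c; split=> //; exists m.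
Qed.

Lemma exists_instance : exists (x : dl_instance) n,
  [/\ valid_dl chain_sig x, valid_re chain_sig (x, 4),
      enc_dl x = instance_code input_codes head_codes (enc_form (Pred 0 [:: 0]))
                   (enc_SID tail_SID) n,
      LinearDeadlock chain_sig x <-> rm_halts Q n &
      LinearReachability chain_sig (x, 4) <-> rm_halts Q n].
Proof.
exists (instance_of B), n; split; [exact: instance_valid| |exact: enc_instance
  |exact: instance_deadlock|exact: instance_reach].
by split; [exact: instance_valid|exact: nst_gt4].
Qed.

End Instance.

Theorem mainTheorem3 :
  exists S : signature,
    sig_ok_12 S /\
    ~ decidable_on enc_dl (valid_dl S) (LinearDeadlock S) /\
    ~ decidable_on enc_re (valid_re S) (LinearReachability S).
Proof.
exists chain_sig; split; [exact: chain_sig_ok|split].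
  apply: (undecidable_by_diagonal (deadlock_code_computable input_codes head_codes
    (enc_form (Pred 0 [:: 0])) (enc_SID tail_SID))) => Q hQ.
  have [x [n [h1 _ h2 h3 _]]] := exists_instance hQ.
  exists n, x; split; [exact: h1|exact: h2|exact: h3].
apply: (undecidable_by_diagonal (reach_code_computable input_codes head_codes
  (enc_form (Pred 0 [:: 0])) (enc_SID tail_SID) 4)) => Q hQ.
have [x [n [_ h1 h2 _ h3]]] := exists_instance hQ.
exists n, (x, 4); split; [exact: h1|exact: (congr1 (cpair^~ 4) h2)|exact: h3].
Qed.
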